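(* Let $\delta\in(0,n]$. (i) If $f\in \mathrm{BMO}(\mathbb R^n,\mathcal H_\infty^\delta)$ with $\|f\|_{\mathrm{BMO}(\mathbb R^n,\mathcal H_\infty^\delta)}\neq 0$, then there exist positive constants $\alpha,\beta$, a function $b\in L^\infty(\mathbb R^n,\mathcal H_\infty^\delta)$ and functions $g_1,g_2\in L^1_{\rm loc}(\mathbb R^n,\mathcal H_\infty^\delta)$ such that $$f=\alpha\ln\mathcal M_{\mathcal H_\infty^\delta}g_1-\beta\ln\mathcal M_{\mathcal H_\infty^\delta}g_2+b$$ and $$\alpha+\beta+\|b\|_{L^\infty(\mathbb R^n,\mathcal H_\infty^\delta)}\le C\|f\|_{\mathrm{BMO}(\mathbb R^n,\mathcal H_\infty^\delta)},$$ where $C$ is a positive constant depending only on $n$ and $\delta$. (ii) Conversely, let $\alpha,\beta\in(0,\infty)$, $b\in L^\infty(\mathbb R^n,\mathcal H_\infty^\delta)$ and $g_1,g_2\in L^1_{\rm loc}(\mathbb R^n,\mathcal H_\infty^\delta)$. If $\mathcal M_{\mathcal H_\infty^\delta}g_i(x)<\infty$ for $\mathcal H_\infty^\delta$-almost every $x\in\mathbb R^n$, $i\in\{1,2\}$, then $$f:=\alpha\ln\mathcal M_{\mathcal H_\infty^\delta}g_1-\beta\ln\mathcal M_{\mathcal H_\infty^\delta}g_2+b\in \mathrm{BMO}(\mathbb R^n,\mathcal H_\infty^\delta)$$ and there exists a positive constant $C$ depending only on $n$ and $\delta$ such that $$\|f\|_{\mathrm{BMO}(\mathbb R^n,\mathcal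 H_\infty^\delta)}\le C\left(\alpha+\beta+\|b\|_{L^\infty(\mathbb R^n,\mathcal H_\infty^\delta)}\right).$$
   Context: A cube $Q\subset\mathbb R^n$ is always left-open and right-closed with sides parallel to the coordinate axes; $l(Q)$ is its edge length. For $\delta\in(0,n]$ and $E\subset\mathbb R^n$ the Hausdorff content is $\mathcal H_\infty^\delta(E)=\inf\{\sum_i l(Q_i)^\delta: E\subset\bigcup_iQ_i\}$, the infimum over all finite or countable coverings by cubes. For any (not necessarily measurable) $f\ge0$, the Choquet integral is $\int_E f(x)\,d\mathcal H_\infty^\delta=\int_0^\infty\mathcal H_\infty^\delta(\{x\in E:f(x)>t\})\,dt$. $L^1_{\rm loc}(\mathbb R^n,\mathcal H_\infty^\delta)$ is the set of functions $f$ with $\int_K|f|\,d\mathcal H_\infty^\delta<\infty$ for every compact $K\subset\mathbb R^n$. ''$\mathcal H_\infty^\delta$-almost every'' means outside a set of content zero. $\ln$ is the logarithm with base $e$. $\|f\|_{L^\infty(\mathbb R^n,\mathcal H_\infty^\delta)}=\inf\{t\in(0,\infty):\mathcal H_\infty^\delta(\{x\in\mathbb R^n:|f(x)|>t\})=0\}$, and $L^\infty(\mathbb R^n,\mathcal H_\infty^\delta)$ is the set of functions for which this is finite. The capacitary Hardy–Littlewood maximal operator is $\mathcal M_{\mathcal H_\infty^\delta}f(x)=\sup_{Q\ni x}\frac1{\mathcal H_\infty^\delta(Q)}\int_Q|f(y)|\,d\mathcal H_\infty^\delta$, the supremum over all cubes $Q$ containing $x$. $\mathrm{BMO}(\mathbb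 R^n,\mathcal H_\infty^\delta)$ is the set of $f\in L^1_{\rm loc}(\mathbb R^n,\mathcal H_\infty^\delta)$ with $$\|f\|_{\mathrm{BMO}(\mathbb R^n,\mathcal H_\infty^\delta)}=\sup_Q\inf_{c\in\mathbb R}\frac1{\mathcal H_\infty^\delta(Q)}\int_Q|f(x)-c|\,d\mathcal H_\infty^\delta<\infty,$$ the supremum over all finite cubes $Q$.
   Formalization: In (i) the identity for f holds outside a set of content zero (the maximal functions may be infinite at some points); in (ii) it is assumed that the maximal functions of g_1 and g_2 are not identically zero, since otherwise their logarithms are undefined. *)

(* Defs.v *)
From HB Require Import structures.
From mathcomp Require Export all_boot all_order all_algebra.
From mathcomp Require Export all_classical all_reals all_analysis.
Export Order.TTheory GRing.Theory Num.Theory.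
Export numFieldNormedType.Exports.

Set Implicit Arguments.
Unset Strict Implicit.
Unset Printing Implicit Defensive.

Local Open Scope classical_set_scope.
Local Open Scope ring_scope.
Local Open Scope ereal_scope.

(* Functions on R^n take values in \bar R, since maximal functions and their
   logarithms may be infinite. *)

Section HausdorffContent.
Context {R : realType} {n : nat}.
Implicit Types (delta : R) (E Q K : set 'rV[R]_n).
Implicit Types (f : 'rV[R]_n -> \bar R).

Definition cube (a : 'rV[R]_n) (l : R) : set 'rV[R]_n :=
  [set x : 'rV[R]_n | forall i : 'I_n, (a ord0 i < x ord0 i <= a ord0 i + l)%R].

Definition is_cube Q := exists a l, (0 < l)%R /\ Q = cube a l.

(* A finite or countable covering by cubes is indexed by a set D of natural
   numbers. *)
Definition cube_covering E (D : set nat) (a : nat -> 'rV[R]_n) (l : nat -> R) :=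
  (forall i, D i -> (0 < l i)%R) /\ E `<=` \bigcup_(i in D) cube (a i) (l i).

Definition hcontent delta E : \bar R :=
  ereal_inf [set s | exists D a l, cube_covering E D a l /\
                       s = \esum_(i in D) (l i `^ delta)%:E].

Definition hc_ae delta (P : 'rV[R]_n -> Prop) :=
  exists N, hcontent delta N = 0 /\ forall x, ~ N x -> P x.

(* Only meaningful for f >= 0. *)
Definition choquet delta E f : \bar R :=
  \int[lebesgue_measure]_(t in `]0%R, +oo[)
    hcontent delta [set x | E x /\ t%:E < f x].

Definition hc_mean delta Q f : \bar R :=
  (hcontent delta Q)^-1 * choquet delta Q f.

Definition hc_L1loc delta f :=
  forall K, compact K -> choquet delta K (fun x => `|f x|) < +oo.

Definition hc_Linfty_norm delta f : \bar R :=
  ereal_inf [set t%:E | t in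
    [set t : R | (0 < t)%R /\ hcontent delta [set x | t%:E < `|f x|] = 0]].

Definition hc_Linfty delta f := hc_Linfty_norm delta f < +oo.

Definition hc_maximal delta f (x : 'rV[R]_n) : \bar R :=
  ereal_sup [set hc_mean delta Q (fun y => `|f y|) | Q in
    [set Q | is_cube Q /\ Q x]].

Definition hc_BMO_norm delta f : \bar R :=
  ereal_sup [set ereal_inf [set hc_mean delta Q (fun x => `|f x - c%:E|) |
                              c in [set: R]] | Q in is_cube].

Definition hc_BMO delta f := hc_L1loc delta f /\ hc_BMO_norm delta f < +oo.

(* lne 0 = -oo and lne +oo = +oo.  Where the sum has the form oo - oo it takes
   the default value -oo. *)
Definition log_maximal_diff delta (alpha beta : R) (g1 g2 b : 'rV[R]_n -> \bar R)
    (x : 'rV[R]_n) : \bar R :=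
  alpha%:E * lne (hc_maximal delta g1 x)
  - beta%:E * lne (hc_maximal delta g2 x) + b x.

End HausdorffContent.

(* Main.v *)
Require Import Defs.
From mathcomp Require Import measurable_realfun ring lra zify.

(* For (ii) we follow Coifman and Rochberg: on a cube Q, the maximal function of g
   is at least Lambda, the supremum of the means over cubes containing Q, and it
   exceeds s Lambda on a subset of content at most C / s times that of Q.  Hence
   ln (M g) - ln Lambda is exponentially integrable on Q.  The weak-type bound holds
   for contents because heavy dyadic cubes can be thinned out greedily to a packed
   family, on which the content is additive up to a constant.

   For (i), let m_k(x) be a nearly optimal constant for f on the cube of centre x and
   edge 2^(k+1), and let a_k be a regularization of m_k that is Lipschitz at scale
   2^k.  The play operator with clearance W splits the displacement of each path
   k |-> a_k(x), k -> -oo, into a rise u(x) and a fall v(x), up to an error O(W).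
   Paths over points at distance at most 2^j differ by a summable amount at scales
   above 2^j, so on a cube the rise is, up to O(W), a constant plus the nonnegative
   rise at finer scales.  By a John-Nirenberg argument the latter is exponentially
   integrable when W is a large multiple of the BMO norm, whence M exp(u / W) is
   comparable with exp(u / W).  The same holds for v, and f - (u - v) is within O(W)
   of a constant outside a set of content zero, by a density argument. *)

Set Implicit Arguments.
Unset Strict Implicit.
Unset Printing Implicit Defensive.

Local Open Scope classical_set_scope.
Local Open Scope ring_scope.
Local Open Scope ereal_scope.

(** * Hausdorff content *)

Section Content.
Context {R : realType} {n : nat}.
Variable delta : R.
Local Notation H := (@hcontent R n delta).
Local Notation cube := (@cube R n).
Implicit Types (E A B : set 'rV[R]_n).

(** The content is only subadditive, and no sublinearity of the Choquet integral in the function is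
    used: estimates are inclusions of level sets followed by subadditivity of the content, and
    integrals are compared level by level. The near-optimal constants are arbitrary choices that may
    jump by a bounded amount at every scale. Hence their variation along a path may be infinite, and
    their differences over neighbouring points need not be summable over coarse scales. The
    clearance removes the first defect, since oscillation within it produces no rise; the
    regularization removes the second. The clearance is large enough that each further [W] of rise
    costs a factor [expR (- 2)] in content. The tail of exp(u / W) is then of order t^-2, which is
    integrable; a factor [expR (- 1)] would be borderline. All thresholds are proportional to the
    bound [A] on the mean oscillation, and the errors measured in units of [W] are bounded in terms
    of n and delta. This is why the constant in (i) does not depend on f. *)

Lemma hcontent_ge0 E : 0 <= H E.
Proof.
apply: le_ereal_inf_tmp => _ [D [a [l [_ ->]]]].
by apply: esum_ge0 => i _; rewrite lee_fin powR_ge0.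
Qed.
#[local] Hint Resolve hcontent_ge0 : core.

Lemma le_hcontent A B : A `<=` B -> H A <= H B.
Proof.
move=> AB; apply: ereal_inf_le_tmp => _ [D [a [l [[l0 cov] ->]]]].
by exists D, a, l; split=> //; split=> //; apply: subset_trans cov.
Qed.

(** Transport along [pickle]; single cubes, pairs of indices and dyadic nodes are all used as index
    types. *)
Lemma hcontent_le_cover (I : countType) (D : set I) (a : I -> 'rV[R]_n)
    (l : I -> R) E :
  (forall i, D i -> (0 < l i)%R) -> E `<=` \bigcup_(i in D) cube (a i) (l i) ->
  H E <= \esum_(i in D) (l i `^ delta)%:E.
Proof.
move=> l0 cov; apply: ereal_inf_lbound.
exists (pickle @` D), (fun k => if unpickle k is Some i then a i else 0%R),
  (fun k => if unpickle k is Some i then l i else 0%R); split.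
  split=> [_ [i Di <-]|]; first by rewrite pickleK; exact: l0.
  by move=> x /cov[i Di xi]; exists (pickle i); [exists i|rewrite pickleK].
rewrite esum_image; last by move=> i j _ _; exact: (pcan_inj pickleK).
by apply: eq_esum => i _; rewrite pickleK.
Qed.

Lemma hcontent_cube_le a (l : R) : (0 < l)%R -> H (cube a l) <= (l `^ delta)%:E.
Proof.
move=> l0; apply: le_trans (@hcontent_le_cover unit setT (fun=> a) (fun=> l) _ _ _) _ => //.
  by move=> x ax; exists tt.
rewrite (_ : [set: unit] = [set tt]) ?esum_set1 ?lee_fin ?powR_ge0//.
by apply/seteqP; split=> // -[].
Qed.

Lemma hcontent_approx E (eps : R) : H E < +oo -> (0 < eps)%R ->
  exists D a l, cube_covering E D a l /\
    \esum_(i in D) (l i `^ delta)%:E <= H E + eps%:E.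
Proof.
move=> Efin e0.
have Efn : H E \is a fin_num by rewrite ge0_fin_numE.
have [_ [D [a [l [cov ->]]]] lt] := lb_ereal_inf_adherent e0 Efn.
by exists D, a, l; split=> //; apply: ltW.
Qed.

Lemma hcontent_sub_nat (D : set nat) (A : nat -> set 'rV[R]_n) E :
  E `<=` \bigcup_(i in D) A i -> H E <= \esum_(i in D) H (A i).
Proof.
move=> EA.
have [[i [Di]]|fin] := pselect (exists i, D i /\ H (A i) = +oo).
  move=> Aoo; rewrite (_ : esum _ _ = +oo) ?leey//; apply/eqP; rewrite -leye_eq.
  by apply: esum_ge; exists [set i]; [split=> // _ ->|rewrite fsbig_set1 Aoo].
have {}fin i : D i -> H (A i) < +oo.
  by move=> Di; rewrite ltey; apply/eqP => Aoo; apply: fin; exists i.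
apply/lee_addgt0Pr => e e0.
have : forall i, exists c : set nat * (nat -> 'rV[R]_n) * (nat -> R), D i ->
    cube_covering (A i) c.1.1 c.1.2 c.2 /\
    \esum_(j in c.1.1) (c.2 j `^ delta)%:E <= H (A i) + (e / (2 ^ i.+1)%:R)%:E.
  move=> i; have [Di|nDi] := pselect (D i); last first.
    by exists (set0, fun=> 0%R, fun=> 0%R).
  have [||D' [a [l [c1 c2]]]] := @hcontent_approx (A i) (e / (2 ^ i.+1)%:R).
  - exact: fin.
  - by rewrite divr_gt0// ltr0n expn_gt0.
  - by exists (D', a, l).
move=> /choice[c cP].
apply: le_trans (@hcontent_le_cover _ (D `*`` (fun i => (c i).1.1))
  (fun k => (c k.1).1.2 k.2) (fun k => (c k.1).2 k.2) E _ _) _.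
- by move=> [i j]/= [Di cij]; have [[+ _] _] := cP i Di; apply.
- move=> x /EA[i Di Aix]; have [[_ /(_ _ Aix)[j cj xj]] _] := cP i Di.
  by exists (i, j).
rewrite -(@esum_esum _ _ _ D (fun i => (c i).1.1)
   (fun i j => ((c i).2 j `^ delta)%:E)); last first.
  by move=> i j _ _; rewrite lee_fin powR_ge0.
apply: (@le_trans _ _ (\esum_(i in D) (H (A i) + (e / (2 ^ i.+1)%:R)%:E))).
  by apply: le_esum => i Di; have [] := cP i Di.
have := @epsilon_trick R (fun i => H (A i)) e (fun i => i \in D).
rewrite !nneseries_esum//=; last first.
  by move=> i _; rewrite adde_ge0// lee_fin divr_ge0// ltW.
by rewrite set_mem_set; apply=> //; exact: ltW.
Qed.

Lemma hcontent_sub (I : countType) (D : set I) (A : I -> set 'rV[R]_n) E :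
  E `<=` \bigcup_(i in D) A i -> H E <= \esum_(i in D) H (A i).
Proof.
move=> EA.
apply: le_trans (@hcontent_sub_nat (pickle @` D)
  (fun k => if unpickle k is Some i then A i else set0) E _) _.
  by move=> x /EA[i Di Aix]; exists (pickle i); [exists i|rewrite pickleK].
rewrite esum_image; last by move=> i j _ _; exact: (pcan_inj pickleK).
by apply: le_esum => i _; rewrite pickleK.
Qed.

Lemma hcontent0 : H set0 = 0.
Proof.
apply/eqP; rewrite eq_le hcontent_ge0 andbT.
by apply: le_trans (@hcontent_sub _ set0 (fun _ : nat => set0) _ _) _;
  rewrite ?esum_set0.
Qed.

Lemma hcontent_big (I : finType) (A : I -> set 'rV[R]_n) E :
  E `<=` \bigcup_i A i -> H E <= \sum_i H (A i).
Proof.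
move=> EA; apply: le_trans (@hcontent_sub I setT A E EA) _.
have -> : [set: I] = [set` enum I].
  by apply/seteqP; split=> i //= _; rewrite mem_enum.
by rewrite esum_fset// -fsbig_seq ?enum_uniq// big_enum.
Qed.

Lemma hcontentU A B : H (A `|` B) <= H A + H B.
Proof.
apply: le_trans (@hcontent_big _ (fun b : bool => if b then A else B) _ _) _.
  by move=> x [xA|xB]; [exists true|exists false].
by rewrite big_bool.
Qed.

Lemma hcontentUnull A B : H B = 0 -> H (A `|` B) = H A.
Proof.
move=> B0; apply/eqP; rewrite eq_le andbC le_hcontent/=; last by move=> x; left.
by apply: le_trans (hcontentU _ _) _; rewrite B0 adde0.
Qed.

Lemma card_count_interval (N : nat) (s c d : R) : (0 < s)%R -> (c <= d)%R ->
  (#|[pred m : 'I_N | (c < s * m%:R <= d)%R]|%:R <= (d - c) / s + 1)%R.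
Proof.
move=> s0 cd; set A := [pred m : 'I_N | _].
have [m0 Am0|A0] := pickP A; last first.
  by rewrite (eq_card0 A0) addr_ge0// divr_ge0 ?subr_ge0// ltW.
case: (@arg_minnP _ m0 A (fun m => val m) Am0) => {Am0} m1 Am1 min1.
set k := (Num.truncn ((d - c) / s)).+1.
have sub : {subset map val (enum A) <= iota m1 k}.
  move=> _ /mapP[m + ->]; rewrite mem_enum => Am.
  have m1m := min1 _ Am; rewrite mem_iota m1m/=.
  move: Am Am1 => /andP[_ h1] /andP[h2 _].
  rewrite -ltn_subLR// /k ltnS truncn_ge_nat ?divr_ge0 ?subr_ge0// ?(ltW s0)//.
  by rewrite ler_pdivlMr// natrB//; lra.
have := uniq_leq_size _ sub.
rewrite map_inj_uniq ?enum_uniq; last exact: val_inj.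
move=> /(_ isT); rewrite size_map -cardE size_iota => le.
rewrite (@le_trans _ _ k%:R)//; first by rewrite ler_nat.
by rewrite -natr1 lerD2r truncn_le divr_ge0 ?subr_ge0// ltW.
Qed.
End Content.

(** * Lower bound for the content of a cube *)

Section CubeLower.
Context {R : realType} {n : nat}.

(* Counts the points of a lattice of mesh [l / N] in the covered cube: for large
   [N] a cube of edge [r k] contains at most [(2 * r k * N / l) ^ n] of them. *)
Lemma finite_cube_cover_volume (I : eqType) (s : seq I) (a : 'rV[R]_n) (l : R)
    (b : I -> 'rV[R]_n) (r : I -> R) : (0 < l)%R -> (forall k, k \in s -> 0 < r k)%R ->
  (forall x : 'rV[R]_n, (forall i, a ord0 i <= x ord0 i <= a ord0 i + l)%R ->
     exists2 k, k \in s & cube (b k) (r k) x) ->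
  (l ^+ n <= \sum_(k <- s) (2 * r k) ^+ n)%R.
Proof.
move=> l0 r0 cov.
have [N N0 Nr] : exists2 N, (0 < N)%N & forall k, k \in s -> (l <= N%:R * r k)%R.
  elim: s r0 {cov} => [|k s IH] r0; first by exists 1%N.
  have [|N N0 Nr] := IH; first by move=> j js; apply: r0; rewrite inE js orbT.
  have rk0 : (0 < r k)%R by apply: r0; rewrite inE eqxx.
  exists (maxn N (Num.truncn (l / r k)).+1); first by rewrite leq_max N0.
  move=> j; rewrite inE => /predU1P[->|js].
    rewrite -ler_pdivrMr//; apply/ltW/(lt_le_trans (truncnS_gt _)).
    by rewrite ler_nat leq_maxr.
  apply: le_trans (Nr _ js) _; rewrite ler_pM2r ?ler_nat ?leq_maxl//.
  by apply: r0; rewrite inE js orbT.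
have NR0 : (0 < N%:R :> R)%R by rewrite ltr0n.
pose h := (l / N%:R)%R; have h0 : (0 < h)%R by rewrite divr_gt0.
pose pt (v : {ffun 'I_n -> 'I_N}) : 'rV[R]_n := \row_i (a ord0 i + h * (v i)%:R)%R.
pose S k (i : 'I_n) := [pred m : 'I_N | (b k ord0 i - a ord0 i < h * m%:R <=
    b k ord0 i - a ord0 i + r k)%R].
have cardS k : k \in s -> (#|family (S k)|%:R <= (2 * r k / h) ^+ n :> R)%R.
  move=> ks; rewrite card_family foldrE big_map big_enum /=.
  rewrite natr_prod -[n in leRHS]card_ord -prodr_const; apply: ler_prod => i _.
  rewrite ler0n/=; apply: le_trans (card_count_interval _ h0 _) _.
    by rewrite lerDl ltW// r0.
  rewrite addrAC subrr add0r mulrDl mul1r mulrDl lerD2l.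
  by rewrite ler_pdivlMr// mul1r /h ler_pdivrMr// mulrC Nr.
have : ((N%:R : R) ^+ n <= \sum_(k <- s) (2 * r k / h) ^+ n)%R.
  have -> : ((N%:R : R) ^+ n = #|{ffun 'I_n -> 'I_N}|%:R)%R.
    by rewrite card_ffun !card_ord natrX.
  rewrite [leRHS]big_seq; apply: le_trans (ler_sum _ (fun k ks => cardS k ks)).
  rewrite -natr_sum ler_nat -big_seq.
  rewrite -sum1_card.
  under [X in (_ <= X)%N]eq_bigr do rewrite -sum1_card big_mkcond/=.
  rewrite exchange_big/=; apply: leq_sum => v _.
  have [k ks /= bk] : exists2 k, k \in s & cube (b k) (r k) (pt v).
    apply: cov => i; rewrite mxE lerDl mulr_ge0 ?(ltW h0) ?ler0n//= lerD2l.
    by rewrite /h mulrAC ler_pdivrMr// ler_pM2l// ler_nat ltnW.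
  rewrite (big_rem k)//= ifT ?leq_addr//; apply/familyP => i.
  by rewrite inE; have := bk i; rewrite mxE => /andP[? ?]; apply/andP; split; lra.
move=> le; have := ler_wpM2r (exprn_ge0 n (ltW h0)) le.
rewrite -exprMn mulrC divfK ?gt_eqF// mulr_suml.
under eq_bigr do rewrite -exprMn divfK ?gt_eqF//.
by [].
Qed.

Lemma open_box (b : 'rV[R]_n) (r : R) :
  open [set x : 'rV[R]_n | forall i, (b ord0 i < x ord0 i < b ord0 i + r)%R].
Proof.
rewrite openE => x xb; apply: (@filter_forall _ _
  (fun i (y : 'rV[R]_n) => (b ord0 i < y ord0 i < b ord0 i + r)%R) _
  (nbhs_filter x)) => i.
apply: (@coord_continuous R 1 n ord0 i x
  [set` `]b ord0 i, b ord0 i + r[%R]).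
apply: open_nbhs_nbhs; split; first exact: interval_open.
by rewrite /= in_itv/=; exact: xb.
Qed.

Variable delta : R.
Hypothesis delta_gt0 : (0 < delta)%R.
Hypothesis delta_le : (delta <= n%:R)%R.
Local Notation H := (@hcontent R n delta).

(** The 8 collects three factors 2: the passage to a closed cube of half the edge, the enlargement
    of the covering cubes to open ones, and the lattice count in [finite_cube_cover_volume]. *)
Definition kappa : R := ((8^-1)%R `^ delta).

Lemma kappa_gt0 : (0 < kappa)%R.
Proof. by rewrite powR_gt0// invr_gt0. Qed.

(** A cube is not compact, so a closed cube of half the edge is covered by open enlargements of the
    given cubes; a finite subcover is then compared by volume. *)
Lemma hcontent_cube_ge a (l : R) : (0 < l)%R ->
  (kappa * l `^ delta)%:E <= H (cube a l).
Proof.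
move=> l0; apply: le_ereal_inf_tmp => _ [D [b [r [[r0 cov] ->]]]].
pose K := [set x : 'rV[R]_n | forall i, [set` `[a ord0 i + l / 2, a ord0 i + l]%R] (x ord0 i)].
have cK : compact K.
  apply: (@rV_compact R n (fun i => [set` `[a ord0 i + l / 2, a ord0 i + l]%R])) => i.
  exact: segment_compact.
pose U k := [set x : 'rV[R]_n | forall i, (b k ord0 i < x ord0 i < b k ord0 i + 2 * r k)%R].
move: cK; rewrite compact_cover => /(_ nat D U).
have Uo i : D i -> open (U i) by move=> _; exact: open_box.
have KU : K `<=` cover D U.
  move=> x Kx; have [k Dk xk] : (\bigcup_(i in D) cube (b i) (r i)) x.
    apply: cov => i; have := Kx i; rewrite /= in_itv/= => /andP[? ->].
    by rewrite andbT; lra.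
  exists k => // i; have := xk i; have := r0 _ Dk => ? /andP[? ?].
  by apply/andP; split; lra.
move=> /(_ Uo KU)[F FD FK].
set s := finmap.enum_fset F.
have FD' k : k \in s -> D k by move=> /FD /set_mem.
have l20 : (0 < l / 2)%R by rewrite divr_gt0.
pose a' : 'rV[R]_n := \row_i (a ord0 i + l / 2)%R.
have := @finite_cube_cover_volume nat s a' (l / 2) b (fun k => 2 * r k)%R l20.
have F2 k : k \in s -> (0 < 2 * r k)%R by move=> /FD'/r0; lra.
move=> /(_ F2) vol.
have {}vol : ((l / 2) ^+ n <= \sum_(k <- s) (2 * (2 * r k)) ^+ n)%R.
  apply: vol => x xa; have [|k kF Ux] := FK x.
    move=> i; have := xa i; rewrite mxE /= in_itv/= => /andP[-> /=].
    by rewrite -addrA -splitr.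
  by exists k => // i; have /andP[-> /ltW ->] := Ux i.
have {vol} : (1 <= \sum_(k <- s) (8 * r k / l) ^+ n)%R.
  have ln0 : (0 < (l / 2) ^+ n)%R by rewrite exprn_gt0.
  move: vol; rewrite -{1}[X in (X <= _)%R]mulr1 -ler_pdivlMl// => /le_trans; apply.
  rewrite mulr_sumr ler_sum// => k _; rewrite -exprVn -exprMn.
  rewrite le_eqVlt; apply/orP; left; apply/eqP; congr (_ ^+ n)%R; field; lra.
move=> vol.
have {vol} : (1 <= \sum_(k <- s) (8 * r k / l) `^ delta)%R.
  (* If one ratio is at least 1, its power alone suffices; otherwise lowering the exponent from [n]
     to [delta] increases every term. *)
  have [/hasP[k kF k1]|/hasPn small] := boolP (has (fun k => 1 <= 8 * r k / l)%R s).
    rewrite (big_rem k)//= -[leLHS]addr0 lerD//; last first.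
      by rewrite sumr_ge0// => j _; rewrite powR_ge0.
    by rewrite -[leLHS](powRr0 (8 * r k / l)) ler_powR// ltW.
  apply: le_trans vol _; rewrite big_seq [leRHS]big_seq ler_sum// => k kF.
  have k0 : (0 < 8 * r k / l)%R by have := r0 _ (FD' _ kF) => ?; rewrite divr_gt0// mulr_gt0.
  rewrite -powR_mulrn ?(ltW k0)// ger_powR// k0/=; apply: ltW.
  by rewrite ltNge small.
move=> vol.
apply: (@le_trans _ _ (\sum_(k <- s) (r k `^ delta)%:E)); last first.
  apply: esum_ge; exists [set` s]; last by rewrite -fsbig_seq// finmap.fset_uniq.
  by split; [exact: finite_seq|move=> k /= /FD'].
rewrite sumEFin lee_fin /kappa -powRM ?invr_ge0 ?(ltW l0)//.
have c0 : (0 < (8^-1 * l) `^ delta)%R by rewrite powR_gt0// mulr_gt0 ?invr_gt0.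
rewrite -[leLHS]mulr1; apply: le_trans (ler_wpM2l (ltW c0) vol) _.
rewrite mulr_sumr big_seq [leRHS]big_seq ler_sum// => k kF.
have rk := r0 _ (FD' _ kF).
rewrite -powRM; [|lra|by rewrite ltW// divr_gt0 ?mulr_gt0].
rewrite le_eqVlt; apply/orP; left; apply/eqP; congr (_ `^ _)%R; field; lra.
Qed.

End CubeLower.

(** * Choquet integral *)

Section Integral.
Context {R : realType}.
Local Notation mu := (@lebesgue_measure R).

(** A common majorant for Choquet integrals: its primitive is elementary, and up to constants it
    dominates both the exponential tails of the converse and the quadratic tails of the weights. *)
Lemma integral0y_rational_tail (T : R) : (0 < T)%R ->
  \int[mu]_(t in `[0%R, +oo[) (T ^+ 2 / (T + t) ^+ 2)%:E = T%:E.
Proof.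
move=> T0; pose F t : R := (- (T ^+ 2 * (T + t)^-1))%R.
have dF (x : R) : (0 <= x)%R -> is_derive x 1%R F (T ^+ 2 / (T + x) ^+ 2)%R.
  move=> x0; have Tx : (T + x != 0)%R by rewrite gt_eqF// ltr_wpDr.
  by apply: is_derive_eq; rewrite add0r /GRing.scale/= mulr1 mulrN opprK.
have cf (x : R) : (0 <= x)%R -> {for x, continuous (fun t => T ^+ 2 / (T + t) ^+ 2)%R}.
  move=> x0; apply: cvgM; first exact: cvg_cst.
  apply: cvgV; first by rewrite expf_neq0// gt_eqF// ltr_wpDr.
  by apply: cvgM; apply: cvgD; [exact: cvg_cst|exact: cvg_id|exact: cvg_cst|exact: cvg_id].
rewrite (@ge0_continuous_FTC2y _ _ F _ 0%R).
- by rewrite /F addr0 -EFinB; congr EFin; field; rewrite gt_eqF.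
- by move=> x _; rewrite mulr_ge0 ?invr_ge0 ?sqr_ge0.
- apply/continuous_within_itvcyP; split.
    by move=> x; rewrite in_itv/= andbT => x0; apply: cf; exact: ltW.
  by apply: cvg_at_right_filter; exact: cf.
- rewrite -oppr0; apply: cvgN; rewrite -(mulr0 (T ^+ 2)%R); apply: cvgM; first exact: cvg_cst.
  apply/gtr0_cvgV0; first by near=> x; rewrite addr_gt0//; near: x; apply: nbhs_pinfty_gt; rewrite num_real.
  apply/cvgryPge => A; near=> x; apply: (@le_trans _ _ x); last first.
    by rewrite lerDr ltW.
  by near: x; apply: nbhs_pinfty_ge; rewrite num_real.
- by move=> x x0; have [] := dF x (ltW x0).
- apply: cvg_at_right_filter; apply: differentiable_continuous.
  by apply/derivable1_diffP; have [] := dF _ (lexx 0).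
- move=> x; rewrite in_itv/= andbT => x0.
  by rewrite derive1E; have := dF x (ltW x0) => ?; rewrite derive_val.
Unshelve. all: by end_near. Qed.
End Integral.

Lemma esumZl_le (R : realType) (I : choiceType) (D : set I) (a : I -> R) (c : R) :
  (0 <= c)%R -> (forall i, (0 <= a i)%R) ->
  \esum_(i in D) (c * a i)%:E <= c%:E * \esum_(i in D) (a i)%:E.
Proof.
move=> c0 a0; apply: ge_ereal_sup => _ [X [finX XD] <-].
apply: (@le_trans _ _ (c%:E * \sum_(i \in X) (a i)%:E)); last first.
  by rewrite lee_wpmul2l// esum_ge//; exists X.
rewrite ge0_mule_fsumr; last by move=> i; rewrite lee_fin.
by under eq_fsbigr do rewrite EFinM.
Qed.

(** * Null sets: localization and density *)

Section Null.
Context {R : realType} {n : nat}.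
Variable delta : R.
Hypothesis delta_gt0 : (0 < delta)%R.
Local Notation H := (@hcontent R n delta).
Local Notation cube := (@cube R n).
Implicit Types (E A B Q : set 'rV[R]_n).
Implicit Types (f g : 'rV[R]_n -> \bar R).

Lemma hcontent_null_bigcup (I : countType) (A : I -> set 'rV[R]_n) E :
  (forall i, H (A i) = 0) -> E `<=` \bigcup_i A i -> H E = 0.
Proof.
move=> A0 /hcontent_sub le; apply/eqP; rewrite eq_le hcontent_ge0 andbT.
by apply: le_trans (le delta) _; rewrite esum1.
Qed.

Lemma hcontent_null_sub A B : A `<=` B -> H B = 0 -> H A = 0.
Proof.
by move=> AB B0; apply/eqP; rewrite eq_le hcontent_ge0 andbT -B0 le_hcontent.
Qed.

Lemma hcontent_null_local (r : R) E : (0 < r)%R ->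
  (forall a, H (E `&` cube a r) = 0) -> H E = 0.
Proof.
move=> r0 loc.
apply: (@hcontent_null_bigcup {ffun 'I_n -> int}
  (fun v => E `&` cube (\row_i (r * (v i)%:~R)%R) r)) => // x Ex.
exists [ffun i => (Num.ceil (x ord0 i / r) - 1)%R] => //; split=> // i.
rewrite mxE ffunE; have /andP[h1 h2] := real_ceil_itv (num_real (x ord0 i / r)).
rewrite mulrC -ltr_pdivlMr// h1/= intrB mulrBl mul1r subrK.
by rewrite -ler_pdivrMr.
Qed.

(* A near-optimal covering of [E] by small cubes shows [H E <= eps * H E]. *)
Lemma hcontent_null_density (eps r1 : R) E : (eps < 1)%R -> (0 < r1)%R ->
  (forall a r, (0 < r)%R -> (r <= r1)%R ->
     H (E `&` cube a r) <= (eps * r `^ delta)%:E) -> H E = 0.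
Proof.
move=> eps1 r10 dens.
have [eps0|eps0] := ltP eps 0%R.
  apply: (@hcontent_null_local r1) => // a; have := dens a r1 r10 (lexx _).
  move=> /(le_trans (hcontent_ge0 _ _)); rewrite lee_fin.
  by rewrite leNgt nmulr_rlt0// powR_gt0.
(* With this edge the total of the near-optimal covering below is at most the weight of a cube of
   edge [r1], so none of its cubes is larger than [r1]. *)
pose r0 := (r1 / 2 `^ delta^-1)%R.
have r00 : (0 < r0)%R by rewrite divr_gt0// powR_gt0.
have r0d : (2 * r0 `^ delta = r1 `^ delta)%R.
  have -> : r1 = (2 `^ delta^-1 * r0)%R by rewrite mulrC divfK// gt_eqF// powR_gt0.
  rewrite powRM ?powR_ge0 ?(ltW r00)// -powRrM mulVf ?gt_eqF// powRr1//.
apply: (@hcontent_null_local r0) => // a; set F := E `&` cube a r0.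
have Fr0 : H F <= (r0 `^ delta)%:E.
  by apply: le_trans (hcontent_cube_le delta a r00); apply: le_hcontent => x [].
have Ffin : H F < +oo by apply: le_lt_trans Fr0 (ltry _).
have Ffn : H F \is a fin_num by rewrite ge0_fin_numE// hcontent_ge0.
pose h := fine (H F); have hE : H F = h%:E by rewrite fineK.
have h0 : (0 <= h)%R by rewrite -lee_fin -hE hcontent_ge0.
have hr0 : (h <= r0 `^ delta)%R by rewrite -lee_fin -hE.
have [h00|hn0] := eqVneq h 0%R; first by rewrite hE h00.
have {hn0}h0 : (0 < h)%R by rewrite lt_def hn0.
pose eta := ((1 - eps) * h)%R.
have eta0 : (0 < eta)%R by rewrite mulr_gt0// subr_gt0.
have [D [b [l [[l0 cov] le]]]] := hcontent_approx Ffin eta0.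
have le2 : \esum_(i in D) (l i `^ delta)%:E <= (h + eta)%:E by rewrite EFinD -hE.
have lr i : D i -> (l i <= r1)%R.
  move=> Di; rewrite leNgt; apply/negP => r1l.
  have : (l i `^ delta)%:E <= (h + eta)%:E.
    apply: le_trans le2; apply: esum_ge; exists [set i]; last by rewrite fsbig_set1.
    by split=> // _ ->.
  rewrite lee_fin; apply/negP; rewrite -ltNge.
  apply: (@le_lt_trans _ _ (r1 `^ delta)%R); last first.
    by apply: gt0_ltr_powR; rewrite ?nnegrE ?(ltW r10) ?(ltW (l0 _ Di)).
  rewrite -r0d /eta; have : (0 <= eps * h)%R by rewrite mulr_ge0 // ltW.
  by lra.
have : H F <= (eps * (h + eta))%:E.
  apply: le_trans (@hcontent_sub _ _ delta _ D (fun i => F `&` cube (b i) (l i)) F _) _.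
    by move=> x Fx; have [i Di xi] := cov x Fx; exists i.
  apply: (@le_trans _ _ (\esum_(i in D) (eps * l i `^ delta)%:E)).
    apply: le_esum => i Di; apply: le_trans (dens (b i) (l i) (l0 _ Di) (lr _ Di)).
    by apply: le_hcontent => x [[]].
  apply: le_trans (esumZl_le _ eps0 _) _; first by move=> i; exact: powR_ge0.
  by rewrite EFinM lee_wpmul2l.
rewrite hE lee_fin /eta.
(* Indeed [eps * (h + eta) = h - h * (1 - eps) ^+ 2], which is below [h]. *)
have : (0 < h * (1 - eps) ^+ 2)%R by rewrite mulr_gt0// exprn_gt0// subr_gt0.
by rewrite expr2 => ? ?; exfalso; lra.
Qed.

End Null.

Section Choquet.
Context {R : realType} {n : nat}.
Variable delta : R.
Local Notation H := (@hcontent R n delta).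
Local Notation cube := (@cube R n).
Local Notation mu := (@lebesgue_measure R).
Implicit Types (E A B Q : set 'rV[R]_n).
Implicit Types (f g : 'rV[R]_n -> \bar R).
Local Notation lev E f := ((fun t : R => H [set x | E x /\ t%:E < f x]) : R -> \bar R).

(** The content of a level set is monotone in the level, so preimages of rays are intervals,
    whatever [f] is. *)
Lemma measurable_level E f : measurable_fun `](0:R)%R, +oo[ (lev E f).
Proof.
apply: measurable_funTS.
apply: (measurability _ (ErealGenOInfty.measurableE R)) => /= _ [_ [c ->] <-].
rewrite setTI; apply: is_interval_measurable => s t /=.
rewrite !in_itv/= !andbT => _ ct u /andP[_ ut].
rewrite in_itv/= andbT; apply: lt_le_trans ct _; apply: le_hcontent => x [Ex tf].
by split=> //; apply: le_lt_trans tf; rewrite lee_fin.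
Qed.

Lemma choquet_ge0 E f : 0 <= choquet delta E f.
Proof. by apply: integral_ge0 => t _; exact: hcontent_ge0. Qed.

Lemma le_choquet E E' f g N : H N = 0 -> E `<=` E' ->
  (forall x, E x -> ~ N x -> f x <= g x) ->
  choquet delta E f <= choquet delta E' g.
Proof.
move=> N0 EE' fg; apply: ge0_le_integral => //=.
- by move=> t _; exact: hcontent_ge0.
- exact: measurable_level.
- exact: measurable_level.
move=> t _; rewrite -(hcontentUnull [set x | E' x /\ t%:E < g x] N0).
apply: le_hcontent => x [Ex tf]; have [Nx|Nx] := pselect (N x); [by right|left].
by split; [exact: EE'|exact: lt_le_trans tf (fg _ Ex Nx)].
Qed.

Lemma choquet_chebyshev E f (s : R) : (0 <= s)%R ->
  s%:E * H [set x | E x /\ s%:E < f x] <= choquet delta E f.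
Proof.
move=> s0; apply: (@le_trans _ _ (\int[mu]_(t in `](0:R)%R, s]) lev E f t)); last first.
  apply: ge0_subset_integral => //; first exact: measurable_level.
    by move=> t _; exact: hcontent_ge0.
  by move=> t /=; rewrite !in_itv/= => /andP[-> _].
have -> : s%:E * H [set x | E x /\ s%:E < f x] =
    \int[mu]_(t in `](0:R)%R, s]) cst (H [set x | E x /\ s%:E < f x]) t.
  rewrite integral_cst//= lebesgue_measure_itv/= lte_fin.
  case: ltP => [_|s0']; first by rewrite sube0 muleC.
  by rewrite (_ : s = 0%R) ?mul0e ?mule0//; apply/eqP; rewrite eq_le s0'.
apply: ge0_le_integral => //=.
- by move=> t _; exact: hcontent_ge0.
- apply: measurable_funS (measurable_level E f) => //.
  by move=> t /=; rewrite !in_itv/= => /andP[-> _].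
move=> t; rewrite in_itv/= => /andP[_ ts]; apply: le_hcontent => x [Ex sf].
by split=> //; apply: le_lt_trans sf; rewrite lee_fin.
Qed.

(** Integrating a packing inequality for contents over the levels gives the same inequality for
    Choquet integrals. *)
Lemma choquet_sum_le (I : eqType) (s : seq I) (P : I -> set 'rV[R]_n) Q f (C : R) :
  (0 <= C)%R -> (forall i, i \in s -> P i `<=` Q) ->
  (forall A, A `<=` Q -> \sum_(i <- s) H (A `&` P i) <= C%:E * H A) ->
  \sum_(i <- s) choquet delta (P i) f <= C%:E * choquet delta Q f.
Proof.
move=> C0 PQ pack; rewrite -ge0_integral_sum//=; last 2 first.
- by move=> i; exact: measurable_level.
- by move=> i t _; exact: hcontent_ge0.
rewrite -ge0_integralZl_EFin//=; last 2 first.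
- by move=> t _; exact: hcontent_ge0.
- exact: measurable_level.
apply: ge0_le_integral => //=.
- by move=> t _; apply: sume_ge0 => i _; exact: hcontent_ge0.
- by apply: emeasurable_sum => i; exact: measurable_level.
- by apply: emeasurable_funM => //; exact: measurable_level.
move=> t _; apply: le_trans (pack _ _); last by move=> x [].
rewrite big_seq [leRHS]big_seq; apply: lee_sum => i si.
by apply: le_hcontent => x [Px tf]; split=> //; split=> //; exact: PQ Px.
Qed.

Lemma choquet_big (I : finType) (A : I -> set 'rV[R]_n) E f :
  E `<=` \bigcup_i A i -> choquet delta E f <= \sum_i choquet delta (A i) f.
Proof.
move=> EA; rewrite -ge0_integral_sum//=; last 2 first.
- by move=> i; exact: measurable_level.
- by move=> i t _; exact: hcontent_ge0.
apply: ge0_le_integral => //=.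
- by move=> t _; exact: hcontent_ge0.
- exact: measurable_level.
- by apply: emeasurable_sum => i; exact: measurable_level.
move=> t _; apply: hcontent_big => x [Ex tf]; have [i _ Aix] := EA x Ex.
by exists i.
Qed.

Lemma choquet_le_tail E f (C T : R) : (0 <= C)%R -> (0 < T)%R ->
  (forall t, (0 < t)%R ->
     H [set x | E x /\ t%:E < f x] <= (C * (T ^+ 2 / (T + t) ^+ 2))%:E) ->
  choquet delta E f <= (C * T)%:E.
Proof.
move=> C0 T0 tail.
have mfr : measurable_fun `](0:R)%R, +oo[ (fun t : R => T ^+ 2 / (T + t) ^+ 2)%R.
  apply: open_continuous_measurable_fun; first exact: interval_open.
  move=> t /set_mem; rewrite /= in_itv/= andbT => t0; apply: cvgM; first exact: cvg_cst.
  apply: cvgV; first by rewrite expf_neq0// gt_eqF// addr_gt0.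
  by apply: cvgM; apply: cvgD; [exact: cvg_cst|exact: cvg_id|exact: cvg_cst|exact: cvg_id].
have mf : measurable_fun `](0:R)%R, +oo[ (fun t : R => (T ^+ 2 / (T + t) ^+ 2)%:E).
  exact/measurable_EFinP.
rewrite EFinM -(integral0y_rational_tail T0).
rewrite -integral_itv_obnd_cbnd//.
have nn t : 0 <= (T ^+ 2 / (T + t) ^+ 2)%:E by rewrite lee_fin mulr_ge0 ?invr_ge0 ?sqr_ge0.
rewrite -ge0_integralZl_EFin//=.
apply: ge0_le_integral => //=.
- by move=> t _; exact: hcontent_ge0.
- exact: measurable_level.
- by apply: emeasurable_funM.
- by move=> t; rewrite in_itv/= andbT => t0; rewrite -EFinM; exact: tail.
Qed.

End Choquet.

Local Close Scope ereal_scope.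

(** * Packing of dyadic cubes *)

Lemma sum_at_most_one_le (R : realDomainType) (I : eqType) (s : seq I) (p : pred I) (c : R) :
  uniq s -> 0 <= c ->
  (forall i j, i \in s -> j \in s -> p i -> p j -> i = j) ->
  \sum_(i <- s | p i) c <= c.
Proof.
move=> us c0 one; have [/hasP[i si pi]|np] := boolP (has p s).
  rewrite (big_rem i)//= pi big1_seq ?addr0// => j /andP[pj].
  by rewrite (rem_filter _ us) mem_filter => /andP[/eqP + sj]; case; exact: one.
by rewrite big_hasC.
Qed.

(* A node [(j, v)] stands for the dyadic cube of generation [j] whose points have
   code [v]. *)
Section Packing.
Context {R : realType} {X : Type} {V : countType}.
Variables (D : set X) (code : nat -> X -> V) (rho : nat -> R).
Hypothesis codeS : forall j x y, D x -> D y ->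
  code j.+1 x = code j.+1 y -> code j x = code j y.
Hypothesis rho_gt0 : forall j, 0 < rho j.
Hypothesis rhoS : forall j, rho j.+1 <= rho j.

Definition nset (P : nat * V) : set X := [set x | D x /\ code P.1 x = P.2].
(** Inclusion alone is void for an empty node; the condition on generations keeps [rho] monotone
    along the relation. *)
Definition descend (P Q : nat * V) : Prop := (Q.1 <= P.1)%N /\ nset P `<=` nset Q.
(** A Carleson packing condition, imposed at every node [Q], whether or not it belongs to the
    family. *)
Definition packed (s : seq (nat * V)) : Prop :=
  forall Q, \sum_(P <- s | `[< descend P Q >]) rho P.1 <= 2 * rho Q.1.

Lemma code_le i j x y : D x -> D y -> (i <= j)%N -> code j x = code j y -> code i x = code i y.
Proof.
move=> Dx Dy; elim: j => [|j IH]; first by rewrite leqn0 => /eqP->.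
rewrite leq_eqVlt => /predU1P[->//|]; rewrite ltnS => ij /(codeS Dx Dy).
exact: IH.
Qed.

Lemma rho_le i j : (i <= j)%N -> rho j <= rho i.
Proof.
by elim: j => [|j IH]; [rewrite leqn0 => /eqP->|
  rewrite leq_eqVlt => /predU1P[->//|/IH]; exact: le_trans].
Qed.

Lemma nset_eq P x : nset P x -> P = (P.1, code P.1 x).
Proof. by case: P => j v [/= _ ->]. Qed.

Lemma descend_meet P Q x : nset P x -> nset Q x -> (Q.1 <= P.1)%N -> descend P Q.
Proof.
move=> [Dx Px] [_ Qx] QP; split=> // y [Dy Py]; split=> //.
by rewrite -Qx; apply: code_le QP _ => //; rewrite Py Px.
Qed.

Lemma descend_refl P : descend P P. Proof. by split. Qed.

Lemma descend_trans Q P U : descend P Q -> descend Q U -> descend P U.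
Proof.
move=> [QP PQ] [UQ QU].
by split; [exact: leq_trans UQ QP|exact: subset_trans PQ QU].
Qed.

Section Maximal.
Variable heavy : set (nat * V).

Definition maximal_heavy (P : nat * V) : Prop :=
  [/\ heavy P, nset P !=set0 & forall Q, heavy Q -> descend P Q -> Q.1 = P.1].

Lemma maximal_heavy_exists P x : heavy P -> nset P x ->
  exists Q, [/\ maximal_heavy Q, descend P Q & nset Q x].
Proof.
move=> hP Px; have Dx := Px.1.
(* The maximal node is the coarsest heavy one along the codes of [x]. *)
have ex : exists i, `[< heavy (i, code i x) >].
  by exists P.1; apply/asboolP; rewrite -(nset_eq Px).
case: (ex_minnP ex) => i /asboolP hi imin.
have iP : (i <= P.1)%N by apply: imin; apply/asboolP; rewrite -(nset_eq Px).
exists (i, code i x); split=> //; last exact: (@descend_meet P (i, code i x) x Px _ iP).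
split=> //; first by exists x.
move=> Q hQ [/= Qi PQ]; have Qx : nset Q x by exact: PQ.
apply/eqP; rewrite eqn_leq Qi/=; apply: imin; apply/asboolP.
by rewrite -(nset_eq Qx).
Qed.

Lemma maximal_heavy_eq P Q x : maximal_heavy P -> maximal_heavy Q ->
  nset P x -> nset Q x -> P = Q.
Proof.
move=> [hP _ mP] [hQ _ mQ] Px Qx.
suff PQ : P.1 = Q.1 by rewrite (nset_eq Px) (nset_eq Qx) PQ.
have [le|/ltnW le] := leqP Q.1 P.1; first by rewrite (mP Q)//; exact: descend_meet Px Qx le.
by rewrite (mQ P)//; exact: descend_meet Qx Px le.
Qed.

End Maximal.

Section Selection.
Variables (F : set (nat * V)) (B : R).
Hypothesis F_neq0 : forall P, F P -> nset P !=set0.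
Hypothesis F_packed_le : forall s, uniq s -> (forall P, P \in s -> F P) -> packed s ->
  \sum_(P <- s) rho P.1 <= B.

(* The nodes are examined in the order of [pickle] and kept greedily as long as
   the kept family stays packed. A node that is refused lies in a node [Q] in
   which the kept nodes already have total weight at least [rho Q.1]: a full
   node. The maximal full nodes form the covering. *)
Fixpoint selection (m : nat) : seq (nat * V) :=
  if m is m'.+1 then
    let s := selection m' in
    if pickle_inv m' is Some P then
      if `[< F P /\ packed (P :: s) >] then P :: s else s
    else s
  else [::].

Lemma selection_packed m : packed (selection m).
Proof.
elim: m => [|m IH] /=; first by move=> Q; rewrite big_nil mulr_ge0 // ltW.
case: pickle_inv => // P; case: asboolP => //; by case.
Qed.

Lemma selection_sub m P : P \in selection m -> F P /\ (pickle P < m)%N.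
Proof.
elim: m => //= m IH; have := @pickle_invK (nat * V)%type m.
case: pickle_inv => [Q /= pQ|_]; last by move=> /IH[? /ltnW].
case: asboolP => [[FQ _]|_]; last by move=> /IH[? /ltnW].
by rewrite inE => /predU1P[->|/IH[? /ltnW]//]; rewrite pQ.
Qed.

Lemma selection_uniq m : uniq (selection m).
Proof.
elim: m => //= m IH; have := @pickle_invK (nat * V)%type m.
case: pickle_inv => [Q /= pQ|//]; case: asboolP => //= _; rewrite IH andbT.
by apply/negP => /selection_sub[_]; rewrite pQ ltnn.
Qed.

Lemma selection_sum_mono (p : pred (nat * V)) m m' : (m <= m')%N ->
  \sum_(P <- selection m | p P) rho P.1 <= \sum_(P <- selection m' | p P) rho P.1.
Proof.
elim: m' => [|m' IH]; first by rewrite leqn0 => /eqP->.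
rewrite leq_eqVlt => /predU1P[->//|/IH le] /=; apply: le_trans le _.
case: pickle_inv => // P; case: asboolP => // _; rewrite big_cons.
by case: ifP => // _; rewrite lerDr ltW.
Qed.

Definition full (m : nat) (Q : nat * V) : Prop :=
  rho Q.1 <= \sum_(P <- selection m | `[< descend P Q >]) rho P.1.

Lemma full_exists P : F P -> exists m Q, full m Q /\ descend P Q.
Proof.
move=> FP; have [pk|npk] := pselect (packed (P :: selection (pickle P))).
  exists (pickle P).+1, P; split; last exact: descend_refl.
  rewrite /full /= pickleK_inv; case: asboolP => [_|[]//].
  rewrite big_cons ifT; last by apply/asboolP; exact: descend_refl.
  by rewrite lerDl sumr_ge0// => Q _; rewrite ltW.
have /existsNP[Q] := npk.
move=> /negP; rewrite -ltNge big_cons; case: asboolP => [PQ|_]; last first.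
  by move=> lt; have := selection_packed (pickle P) Q; rewrite leNgt lt.
(* Refusal means that [rho P.1] and the kept weight in [Q] together exceed [2 * rho Q.1]. As
   [rho P.1 <= rho Q.1], the kept weight exceeds [rho Q.1]; this is where the 2 in [packed] is
   spent. *)
move=> lt; exists (pickle P), Q; split=> //; rewrite /full.
by have := rho_le PQ.1; lra.
Qed.

Lemma full_descend m Q : full m Q -> exists2 P, F P & descend P Q.
Proof.
move=> fQ; have [/hasP[P Ps /asboolP PQ]|np] :=
    boolP (has (fun P => `[< descend P Q >]) (selection m)).
  by exists P => //; have [] := selection_sub Ps.
by move: fQ; rewrite /full big_hasC// leNgt rho_gt0.
Qed.

Lemma packing_cover : exists Cov : set (nat * V),
  [/\ forall Q, Cov Q -> exists2 P, F P & descend P Q,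
      forall P, F P -> exists2 Q, Cov Q & descend P Q &
      (\esum_(Q in Cov) (rho Q.1)%:E <= B%:E)%E].
Proof.
pose Full Q := exists m, full m Q.
exists [set Q | [/\ Full Q, nset Q !=set0 &
  forall Q', Full Q' -> descend Q Q' -> Q'.1 = Q.1]]; split.
- by move=> Q [[m /full_descend]].
- move=> P FP; have [m [Q [fQ PQ]]] := full_exists FP.
  have [x Px] := F_neq0 FP; have FQ : Full Q by exists m.
  have [Q0 [mQ QQ0 Q0x]] := maximal_heavy_exists FQ (PQ.2 _ Px).
  by exists Q0 => //; exact: descend_trans PQ QQ0.
apply: ge_ereal_sup => _ [Y [finY YC] <-].
rewrite fsumEFin// lee_fin fsbig_finite//=; set s := finmap.enum_fset _.
have sY Q : Q \in s -> Y Q by rewrite /s in_fset_set// => /set_mem.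
(* Fullness persists as the selection grows, so finitely many full nodes are full at a common
   stage. *)
have [m fm] : exists m, forall Q, Q \in s -> full m Q.
  have : forall Q, Q \in s -> Full Q by move=> Q /sY /YC[].
  elim: (s) => [|Q t IH] ft; first by exists 0%N.
  have [|m fm] := IH; first by move=> U Ut; apply: ft; rewrite inE Ut orbT.
  have [m' fm'] : Full Q by apply: ft; rewrite inE eqxx.
  exists (maxn m m') => U; rewrite inE => /predU1P[->|Ut].
    by apply: le_trans fm' _; apply: selection_sum_mono; exact: leq_maxr.
  by apply: le_trans (fm _ Ut) _; apply: selection_sum_mono; exact: leq_maxl.
apply: (@le_trans _ _ (\sum_(P <- selection m) rho P.1)); last first.
  apply: F_packed_le; [exact: selection_uniq| |exact: selection_packed].
  by move=> P /selection_sub[].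
(* Each maximal full node is paid for by the kept nodes below it, and by disjointness no kept node
   pays twice. *)
apply: (@le_trans _ _ (\sum_(Q <- s) \sum_(P <- selection m | `[< descend P Q >]) rho P.1)).
  by rewrite big_seq [leRHS]big_seq; apply: ler_sum => Q /fm.
rewrite (exchange_big_dep xpredT)//= big_seq [leRHS]big_seq; apply: ler_sum => P Pm.
have [FP _] := selection_sub Pm; have [x Px] := F_neq0 FP.
apply: sum_at_most_one_le; [exact: finmap.fset_uniq|exact: ltW|].
move=> Q Q' /sY /YC mQ /sY /YC mQ' /asboolP PQ /asboolP PQ'.
by apply: (@maximal_heavy_eq Full Q Q' x) => //; [exact: PQ.2|exact: PQ'.2].
Qed.

End Selection.
End Packing.

Lemma le_esum_subset (R : realType) (I : choiceType) (D D' : set I) (f g : I -> \bar R) :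
  D `<=` D' -> (forall i, D i -> (f i <= g i)%E) ->
  (\esum_(i in D) f i <= \esum_(i in D') g i)%E.
Proof.
move=> DD' fg; apply: ge_ereal_sup => _ [X [fX XD] <-].
apply: esum_ge; exists X; first by split=> //; exact: subset_trans DD'.
by apply: lee_fsum => // i /XD /fg.
Qed.

(** * Dyadic subcubes of a fixed cube *)

Section Nodes.
Context {R : realType} {n : nat}.
Variables (a : 'rV[R]_n) (l : R).
Hypothesis l_gt0 : 0 < l.
Local Notation cube := (@cube R n).
Local Notation Q0 := (cube a l).
Local Notation node := (nat * {ffun 'I_n -> nat})%type.

Definition side (j : nat) : R := l / 2 ^+ j.
(** Cubes are left-open and right-closed, hence the ceiling minus 1; on [Q0] this is nonnegative, so
    that the absolute value changes nothing. *)
Definition code (j : nat) (x : 'rV[R]_n) : {ffun 'I_n -> nat} :=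
  [ffun i => `|Num.ceil ((x ord0 i - a ord0 i) / side j) - 1|%N].
Definition corner (P : node) : 'rV[R]_n := \row_i (a ord0 i + side P.1 * (P.2 i)%:R).
Local Notation ns := (nset Q0 code).
Local Notation desc := (descend Q0 code).

Lemma side_gt0 j : 0 < side j. Proof. by rewrite divr_gt0// exprn_gt0. Qed.

Lemma side0 : side 0 = l. Proof. by rewrite /side expr0 divr1. Qed.

Lemma sideS j : side j = 2 * side j.+1.
Proof. by rewrite /side exprS; field; rewrite expf_neq0. Qed.

Lemma sideE j : side j * 2 ^+ j = l.
Proof. by rewrite /side divfK// expf_neq0. Qed.

Lemma codeP j x i (m : nat) : Q0 x ->
  code j x i = m <-> side j * m%:R < x ord0 i - a ord0 i <= side j * m.+1%:R.
Proof.
move=> Qx; have s0 := side_gt0 j; set t := x ord0 i - a ord0 i.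
have t0 : 0 < t by have /andP[+ _] := Qx i; rewrite -subr_gt0.
rewrite ffunE -/t.
have /andP[h1 h2] := real_ceil_itv (num_real (t / side j)).
have c0 : 0 < Num.ceil (t / side j) by rewrite real_ceil_gt_int ?num_real// divr_gt0.
split=> [<-|/andP[m1 m2]].
  rewrite -natr1 !natr_absz ger0_norm ?subr_ge0 -?gtz0_ge1//.
  rewrite intrB mulr1z subrK -(mulr1z 1) -intrB.
  by rewrite mulrC -ltr_pdivlMr// h1/= mulrC -ler_pdivrMr.
have -> : Num.ceil (t / side j) = m.+1%:Z.
  have e1 : (m.+1%:Z - 1)%:~R = m%:R :> R by rewrite -addn1 PoszD addrK.
  by apply/ceil_def; rewrite e1 -pmulrn ltr_pdivlMr// ler_pdivrMr// mulrC m1/= mulrC.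
by rewrite -addn1 PoszD addrK absz_nat.
Qed.

Lemma code_mem j x i : Q0 x ->
  side j * (code j x i)%:R < x ord0 i - a ord0 i <= side j * (code j x i).+1%:R.
Proof. by move=> Qx; apply/codeP. Qed.

Lemma codeS_half j x i : Q0 x -> code j x i = (code j.+1 x i)./2.
Proof.
move=> Qx; apply/codeP => //; have := code_mem j.+1 i Qx.
rewrite (sideS j); set m := code j.+1 x i => /andP[h1 h2].
have s0 := side_gt0 j.+1; apply/andP; split.
  apply: le_lt_trans h1; rewrite mulrAC mulrC ler_pM2l// -natrM ler_nat.
  by lia.
apply: le_trans h2 _; rewrite -mulrA mulrCA ler_pM2l// -natrM ler_nat.
by lia.
Qed.

Lemma codeS j x y : Q0 x -> Q0 y -> code j.+1 x = code j.+1 y -> code j x = code j y.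
Proof. by move=> Qx Qy E; apply/ffunP => i; rewrite (codeS_half j i Qx) (codeS_half j i Qy) E. Qed.

Lemma nset_sub_cube P : ns P `<=` cube (corner P) (side P.1).
Proof.
move=> x [Qx Px] i; rewrite mxE -Px; have := code_mem P.1 i Qx.
by rewrite -natr1 mulrDr mulr1 => /andP[h1 h2]; apply/andP; split; lra.
Qed.

Lemma nset_cube P : ns P !=set0 -> ns P = cube (corner P) (side P.1).
Proof.
move=> [x [Qx Px]]; apply/seteqP; split; first exact: nset_sub_cube.
have s0 := side_gt0 P.1.
move=> y Py.
have Qy : Q0 y.
  move=> i; have := Py i; rewrite mxE -Px => /andP[h1 h2].
  have c0 : 0 <= side P.1 * (code P.1 x i)%:R by rewrite mulr_ge0 ?ler0n// ltW.
  apply/andP; split; first by lra.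
  have /andP[h3 _] := code_mem P.1 i Qx.
  have /andP[_ h4] := Qx i.
  (* By integrality the code is at most [2 ^ P.1 - 1], so a nonempty node does not stick out of
     [Q0]. *)
  have : side P.1 * (code P.1 x i).+1%:R <= l.
    rewrite -[leRHS](sideE P.1) ler_pM2l// -natrX ler_nat.
    rewrite -(ltr_nat R) natrX -(ltr_pM2l s0) sideE; lra.
  rewrite -natr1 mulrDr mulr1; lra.
split=> //; apply/ffunP => i; apply/codeP => //; have := Py i.
by rewrite mxE -natr1 mulrDr mulr1 => /andP[h1 h2]; apply/andP; split; lra.
Qed.

End Nodes.

Section Weights.
Context {R : realType} {n : nat}.
Variables (delta : R) (a : 'rV[R]_n) (l : R).
Hypothesis delta_gt0 : 0 < delta.
Hypothesis l_gt0 : 0 < l.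
Local Notation H := (@hcontent R n delta).
Local Notation cube := (@cube R n).
Local Notation Q0 := (cube a l).
Local Notation node := (nat * {ffun 'I_n -> nat})%type.
Local Notation side := (side l).
Local Notation code := (code a l).
Local Notation ns := (nset Q0 code).

Definition rho (j : nat) : R := side j `^ delta.

Lemma rho_gt0 j : 0 < rho j. Proof. by rewrite powR_gt0// side_gt0. Qed.

Lemma rhoS j : rho j.+1 <= rho j.
Proof.
apply: ge0_ler_powR; rewrite ?nnegrE ?(ltW (side_gt0 l_gt0 _)) ?(ltW delta_gt0)//.
by rewrite (sideS l j); have := side_gt0 l_gt0 j.+1; lra.
Qed.

Lemma hcontent_nset_le P : (H (ns P) <= (rho P.1)%:E)%E.
Proof.
apply: le_trans (hcontent_cube_le delta (corner a l P) (side_gt0 l_gt0 P.1)).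
by apply: le_hcontent; exact: nset_sub_cube.
Qed.

(** At the first generation with side below [2 * r] the side is still at least [r], so in each
    direction the cube meets at most two codes, between which [e] chooses. For [r > l] the root
    suffices. *)
Lemma cover_by_nodes b r : 0 < r -> exists N : {ffun 'I_n -> bool} -> node,
  [/\ forall e, rho (N e).1 <= 2 `^ delta * r `^ delta,
      r <= l -> forall e, r <= side (N e).1 &
      forall x, Q0 x -> cube b r x -> exists e, ns (N e) x].
Proof.
move=> r0; have [rl|lr] := ltP r l; last first.
  exists (fun=> (0%N, [ffun=> 0%N])); split=> /=.
  - move=> _; rewrite -[leLHS]mul1r /rho side0; apply: ler_pM; rewrite ?powR_ge0//.
      by rewrite -[leLHS](powRr0 2) ler_powR ?ler1n// ltW.
    by apply: ge0_ler_powR; rewrite ?nnegrE ?(ltW r0) ?(ltW l_gt0) ?(ltW delta_gt0).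
  - by move=> rl _; rewrite side0.
  - move=> x Qx _; exists [ffun=> false]; split=> //=; apply/ffunP => i; rewrite [RHS]ffunE.
    apply/codeP => //; rewrite side0 mulr0 mulr1; have /andP[? ?] := Qx i.
    by apply/andP; split; lra.
have ex : exists j, side j < 2 * r.
  have := @near_infty_natSinv_expn_lt R (PosNum (divr_gt0 r0 l_gt0)).
  move=> [j _ /(_ j (leqnn _))] /=; rewrite ltr_pdivlMr//.
  rewrite mulrC mul1r => h; exists j; rewrite /side; apply: (lt_trans h); lra.
case: (ex_minnP ex) => j jr jmin.
have rj : r <= side j.
  case: j jr jmin => [_ _|j jr jmin]; first by rewrite side0 ltW.
  rewrite leNgt; apply/negP => h; have := jmin j; rewrite ltnn => /(_ _)/negP; apply => //.
  by rewrite sideS; lra.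
have s0 := side_gt0 l_gt0 j.
(* The cube may begin outside [Q0]; the maximum with 0 then starts the codes at the boundary. *)
pose t i := Num.truncn (Num.max 0 ((b ord0 i - a ord0 i) / side j)).
exists (fun e : {ffun 'I_n -> bool} => (j, [ffun i => (t i + e i)%N])); split=> //=.
  move=> _; rewrite -powRM ?(ltW r0)//; apply: ge0_ler_powR; rewrite ?nnegrE ?(ltW jr) ?(ltW s0) ?(ltW delta_gt0)//.
  by rewrite mulr_ge0// ltW.
move=> x Qx bx; exists [ffun i => code j x i != t i]; split=> //=.
apply/ffunP => i; rewrite [RHS]ffunE [in RHS]ffunE.
case: eqVneq => [->|ne]; rewrite ?addn0//= addn1.
apply/codeP => //.
set tau := Num.max 0 ((b ord0 i - a ord0 i) / side j).
have tau0 : 0 <= tau by rewrite le_max lexx.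
have /andP[t1 t2] := truncn_itv tau0.
rewrite -/(t i) in t1 t2.
have st1 : side j * (t i)%:R <= side j * tau by rewrite ler_pM2l.
have st2 : side j * tau < side j * (t i).+1%:R by rewrite ltr_pM2l.
have /andP[x1 x2] := Qx i; have /andP[x3 x4] := bx i.
have stau : side j * tau < x ord0 i - a ord0 i.
  rewrite /tau; case: (leP 0 ((b ord0 i - a ord0 i) / side j)) => _.
    by rewrite mulrC divfK ?gt_eqF//; lra.
  by rewrite mulr0; lra.
have stau' : x ord0 i - a ord0 i <= side j * tau + side j.
  have : (b ord0 i - a ord0 i) / side j <= tau by rewrite le_max lexx orbT.
  rewrite ler_pdivrMr// mulrC; lra.
have nt : ~ (side j * (t i)%:R < x ord0 i - a ord0 i <= side j * (t i).+1%:R).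
  by move=> /codeP -/(_ l_gt0 Qx) /eqP; apply/negP.
have xt : side j * (t i).+1%:R < x ord0 i - a ord0 i.
  by rewrite ltNge; apply/negP => h; apply: nt; rewrite h andbT; lra.
rewrite xt/= -[(t i).+2%:R]natr1 mulrDr mulr1; lra.
Qed.

End Weights.

Section DyadicCovering.
Context {R : realType} {n : nat}.
Variables (delta : R) (a : 'rV[R]_n) (l : R).
Hypothesis delta_gt0 : 0 < delta.
Hypothesis l_gt0 : 0 < l.
Local Notation H := (@hcontent R n delta).
Local Notation cube := (@cube R n).
Local Notation Q0 := (cube a l).
Local Notation node := (nat * {ffun 'I_n -> nat})%type.
Local Notation side := (side l).
Local Notation rho := (rho delta l).
Local Notation code := (code a l).
Local Notation ns := (nset Q0 code).
Local Notation desc := (descend Q0 code).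

(** A covering cube is replaced by at most [2 ^ n] nodes. Each is charged, relative to the cube,
    twice 2 to the power [delta] for the packed nodes inside it, and 1 for the only disjoint node
    that contains it. *)
Definition packing_const : R := (2 ^ n)%:R * (2 * 2 `^ delta + 1).

Lemma packing_const_gt0 : 0 < packing_const.
Proof.
by rewrite mulr_gt0 ?ltr0n ?expn_gt0// addr_gt0// mulr_gt0// powR_gt0.
Qed.

Definition disjoint_nodes (s : seq node) : Prop :=
  forall P Q x, P \in s -> Q \in s -> ns P x -> ns Q x -> P = Q.

(* A packed disjoint family makes the content additive up to a constant: a
   covering cube is charged either for the nodes that it nearly contains, which
   is bounded by packing, or for the few larger nodes that it meets. *)
Lemma packed_hcontent (s : seq node) (A : set 'rV[R]_n) :
  uniq s -> disjoint_nodes s -> packed Q0 code rho s -> A `<=` Q0 ->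
  (\sum_(P <- s) H (A `&` ns P) <= packing_const%:E * H A)%E.
Proof.
move=> us ds ps AQ.
have C0 := packing_const_gt0.
rewrite -lee_pdivrMl//; apply: le_ereal_inf_tmp => _ [D [b [r [[r0 cov] ->]]]].
rewrite lee_pdivrMl//.
have : forall i, exists N : {ffun 'I_n -> bool} -> node, D i ->
    (forall e, rho (N e).1 <= 2 `^ delta * r i `^ delta) /\
    (forall x, Q0 x -> cube (b i) (r i) x -> exists e, ns (N e) x).
  move=> i; have [Di|nDi] := pselect (D i); last by exists (fun=> (0%N, [ffun=> 0%N])).
  by have [N [N1 _ N3]] := cover_by_nodes a delta_gt0 l_gt0 (b i) (r0 _ Di); exists N.
move=> /choice[N NP].
pose inside i e P := `[< desc P (N i e) >].
pose contains i e P := `[< desc (N i e) P /\ ns (N i e) !=set0 >].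
(* The charge of [P] to the covering cube [i]: the weight of [P] if [P] lies in a node of [i], and
   the weight of [i] if a nonempty node of [i] lies in [P]. *)
pose c i P : R := \sum_e ((inside i e P)%:R * rho P.1 + (contains i e P)%:R * r i `^ delta).
have c0 i P : 0 <= c i P.
  by apply: sumr_ge0 => e _; rewrite addr_ge0// mulr_ge0 ?ler0n ?powR_ge0.
have rho_ge0 j : 0 <= rho j by rewrite ltW// rho_gt0.
have one_term i e P : (inside i e P)%:R * rho P.1 + (contains i e P)%:R * r i `^ delta <= c i P.
  rewrite /c (bigD1 e)//= lerDl sumr_ge0// => e' _.
  by rewrite addr_ge0// mulr_ge0 ?ler0n ?powR_ge0.
have step1 P : (H (A `&` ns P) <= \esum_(i in D) (c i P)%:E)%E.
  have [[i [e [Di ins]]]|out] := pselect (exists i e, D i /\ desc P (N i e)).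
    apply: (@le_trans _ _ (rho P.1)%:E).
      by apply: le_trans (@hcontent_nset_le R n delta a l l_gt0 P); apply: le_hcontent => x [].
    apply: esum_ge; exists [set i]; first by split=> // _ ->.
    rewrite fsbig_set1 lee_fin; apply: le_trans (one_term i e P).
    rewrite [inside _ _ _]asboolT// mul1r lerDl mulr_ge0 ?ler0n ?powR_ge0//.
  apply: le_trans (@hcontent_le_cover _ _ delta nat
    [set i | D i /\ exists e, desc (N i e) P /\ ns (N i e) !=set0] b r _ _ _) _.
  - by move=> i [/r0].
  - move=> x [Ax Px]; have [i Di xi] := cov x Ax.
    have [_ /(_ x (AQ _ Ax) xi)[e Nx]] := NP i Di.
    exists i => //; split=> //; exists e; split; last by exists x.
    apply: (descend_meet (@codeS R n a l l_gt0) Nx Px).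
    have [le|/ltnW//] := leqP (N i e).1 P.1; exfalso; apply: out.
    by exists i, e; split=> //; exact: (descend_meet (@codeS R n a l l_gt0) Px Nx).
  apply: le_esum_subset => [i []//|i [Di [e conte]]].
  rewrite lee_fin; apply: le_trans (one_term i e P).
  by rewrite [contains _ _ _]asboolT// mul1r lerDr mulr_ge0.
apply: (@le_trans _ _ (\sum_(P <- s) \esum_(i in D) (c i P)%:E)%E).
  by apply: lee_sum => P _; exact: step1.
rewrite -esum_sum; last by move=> i P _ _; rewrite lee_fin.
apply: (@le_trans _ _ (\esum_(i in D) (packing_const * r i `^ delta)%:E)%E); last first.
  by apply: esumZl_le => [|i]; [exact: ltW|exact: powR_ge0].
apply: le_esum => i Di; rewrite sumEFin lee_fin /c exchange_big/=.
apply: (@le_trans _ _ (\sum_(e : {ffun 'I_n -> bool}) (2 * 2 `^ delta + 1) * r i `^ delta)).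
  apply: ler_sum => e _; rewrite big_split/= mulrDl mul1r lerD//.
    apply: (@le_trans _ _ (2 * rho (N i e).1)); last first.
      by rewrite -mulrA ler_pM2l//; have [+ _] := NP i Di; apply.
    apply: le_trans (ps (N i e)); rewrite [leRHS]big_mkcond/=.
    by apply: ler_sum => P _; rewrite /inside; case: asboolP; rewrite ?mul1r ?mul0r.
  apply: (@le_trans _ _ (\sum_(P <- s | contains i e P) r i `^ delta)).
    rewrite [leRHS]big_mkcond/=.
    by apply: ler_sum => P _; case: (contains i e P); rewrite ?mul1r ?mul0r.
  apply: sum_at_most_one_le; rewrite ?powR_ge0// => P P' Ps P's.
  move=> /asboolP[[_ NP1] [x Nx]] /asboolP[[_ NP2] _].
  by apply: (ds P P' x) => //; [exact: NP1|exact: NP2].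
rewrite sumr_const card_ffun card_bool card_ord -[leLHS]mulr_natl mulrA.
exact: lexx.
Qed.

Lemma packed_choquet (s : seq node) (f : 'rV[R]_n -> \bar R) :
  uniq s -> disjoint_nodes s -> packed Q0 code rho s ->
  (\sum_(P <- s) choquet delta (ns P) f <= packing_const%:E * choquet delta Q0 f)%E.
Proof.
move=> us ds ps; apply: choquet_sum_le; first exact: ltW packing_const_gt0.
  by move=> P _ x [].
by move=> A AQ; exact: packed_hcontent.
Qed.

(** Maximal heavy nodes are disjoint, so each packed family of them has weight at most [B], and
    [packing_cover] applies. In the uses below [mu] is a Choquet integral for the weak-type bound
    and the content of a part of the cube for the stopping argument. *)
Lemma dyadic_covering (mu : node -> \bar R) (c B : R) : 0 < c ->
  (forall s, uniq s -> disjoint_nodes s -> packed Q0 code rho s ->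
     (\sum_(P <- s) mu P <= (c * B)%:E)%E) ->
  let heavy := [set P | ((c * rho P.1)%:E <= mu P)%E] in
  exists Cov : set node,
    [/\ forall Q, Cov Q -> exists2 P, maximal_heavy Q0 code heavy P & desc P Q,
        forall P x, heavy P -> ns P x -> exists2 Q, Cov Q & desc P Q &
        (\esum_(Q in Cov) (rho Q.1)%:E <= B%:E)%E].
Proof.
move=> c0 muB heavy.
have [||Cov [C1 C2 C3]] := @packing_cover R _ _ Q0 code rho
  (@codeS R n a l l_gt0) (rho_gt0 delta l_gt0) (rhoS delta_gt0 l_gt0)
  (maximal_heavy Q0 code heavy) B.
- by move=> P [].
- move=> s us sF ps; rewrite -(ler_pM2l c0) -lee_fin; apply: le_trans (muB s us _ ps).
    rewrite mulr_sumr -sumEFin big_seq [leRHS]big_seq; apply: lee_sum => P /sF.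
    by case.
  move=> P Q x Ps Qs Px Qx.
  exact: (maximal_heavy_eq (@codeS R n a l l_gt0) (sF _ Ps) (sF _ Qs) Px Qx).
exists Cov; split=> // P x hP Px.
have [Q [mQ PQ Qx]] := maximal_heavy_exists (@codeS R n a l l_gt0) hP Px.
have [U CU QU] := C2 _ mQ; exists U => //; exact: descend_trans PQ QU.
Qed.

End DyadicCovering.

(** * Maximal functions and the converse *)

Section Mean.
Context {R : realType} {n : nat}.
Variable delta : R.
Hypothesis delta_gt0 : 0 < delta.
Hypothesis delta_le : delta <= n%:R.
Local Notation H := (@hcontent R n delta).
Local Notation cube := (@cube R n).
Implicit Types (f g : 'rV[R]_n -> \bar R).

Lemma hcontent_cube b (r : R) : 0 < r -> exists2 h : R, H (cube b r) = h%:E &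
  0 < h /\ kappa delta * r `^ delta <= h <= r `^ delta.
Proof.
move=> r0.
have le := hcontent_cube_le delta b r0; have ge := hcontent_cube_ge delta_gt0 delta_le b r0.
have fin : H (cube b r) \is a fin_num.
  by rewrite ge0_fin_numE ?hcontent_ge0//; apply: le_lt_trans le (ltry _).
exists (fine (H (cube b r))); rewrite ?fineK// -!lee_fin fineK//; split=> //.
  rewrite -lte_fin fineK//; apply: lt_le_trans ge.
  by rewrite lte_fin mulr_gt0 ?kappa_gt0// powR_gt0.
by rewrite ge.
Qed.

Lemma hc_mean_le b (r c : R) f : 0 < r -> 0 <= c ->
  (choquet delta (cube b r) f <= (c * r `^ delta)%:E)%E ->
  (hc_mean delta (cube b r) f <= (c / kappa delta)%:E)%E.
Proof.
move=> r0 c0 le; have [h hE [h0 /andP[hr _]]] := hcontent_cube b r0.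
rewrite /hc_mean hE inver gt_eqF// lee_pdivrMl//; apply: le_trans le _.
rewrite -EFinM lee_fin mulrCA ler_wpM2l// ler_pdivlMr ?kappa_gt0//.
by rewrite mulrC.
Qed.

Lemma choquet_le_mean b (r c : R) f : 0 < r -> 0 <= c ->
  (hc_mean delta (cube b r) f <= c%:E)%E ->
  (choquet delta (cube b r) f <= (c * r `^ delta)%:E)%E.
Proof.
move=> r0 c0; have [h hE [h0 /andP[_ hr]]] := hcontent_cube b r0.
rewrite /hc_mean hE inver gt_eqF// lee_pdivrMl// => /le_trans; apply.
by rewrite -EFinM lee_fin mulrC ler_wpM2l.
Qed.

Lemma choquet_gt_mean b (r c : R) f : 0 < r -> 0 <= c ->
  (c%:E < hc_mean delta (cube b r) f)%E ->
  ((c * kappa delta * r `^ delta)%:E < choquet delta (cube b r) f)%E.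
Proof.
move=> r0 c0 lt; rewrite ltNge; apply/negP => le.
move: lt; apply/negP; rewrite -leNgt.
apply: le_trans (hc_mean_le r0 _ le) _; first by rewrite mulr_ge0// ltW// kappa_gt0.
by rewrite mulfK ?gt_eqF ?kappa_gt0.
Qed.

Lemma choquet0_set f : choquet delta set0 f = 0%E.
Proof.
rewrite /choquet (eq_integral (cst 0%E)) ?integral0// => t _.
rewrite (_ : [set x | _] = set0) ?hcontent0//.
by apply/seteqP; split=> x [].
Qed.

Lemma cube_union a b (l r : R) : 0 < l -> 0 < r -> exists c m, 0 < m /\
  cube a l `<=` cube c m /\ cube b r `<=` cube c m.
Proof.
move=> l0 r0; pose d := \sum_i `|a ord0 i - b ord0 i|.
have d0 : 0 <= d by exact: sumr_ge0.
have dge i : `|a ord0 i - b ord0 i| <= d.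
  by rewrite /d (bigD1 i)//= lerDl sumr_ge0.
exists (\row_i Num.min (a ord0 i) (b ord0 i)), (l + r + d); split; first lra.
by split=> x xQ i; have := xQ i; have := dge i; rewrite mxE ler_norml;
  case: (leP (a ord0 i) (b ord0 i)) => ? /andP[? ?] /andP[? ?]; apply/andP; split; lra.
Qed.

Lemma hc_mean_ge0 Q f : (0 <= hc_mean delta Q f)%E.
Proof. by rewrite mule_ge0 ?inve_ge0 ?hcontent_ge0 ?choquet_ge0. Qed.

(** The first summand makes the level estimate trivial for small [s]; the second comes from the
    covering by tripled nodes, used for the other [s]. *)
Definition weak_const : R :=
  3 `^ delta / kappa delta +
  3 `^ delta * (@packing_const R n delta * 3 `^ delta * (2 `^ delta * (2 ^ n)%:R) / kappa delta).

Lemma weak_const_gt0 : 0 < weak_const.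
Proof.
have k0 := kappa_gt0 delta; have p0 := @packing_const_gt0 R n delta.
have p2 : 0 < (2 `^ delta : R) by rewrite powR_gt0.
have p3 : 0 < (3 `^ delta : R) by rewrite powR_gt0.
by rewrite addr_gt0 ?mulr_gt0 ?invr_gt0 ?ltr0n ?expn_gt0.
Qed.

(* [Lam] is the supremum of the means of [|g|] over the cubes containing
   [cube a l]. Cubes larger than [l] contribute at most a constant times [Lam] to
   the maximal function, and smaller ones are controlled by a weak-type bound in
   the triple of [cube a l]. *)
Lemma maximal_level_estimate g a (l : R) : 0 < l ->
  (exists x, hc_maximal delta g x <> 0%E) ->
  hc_ae delta (fun x => hc_maximal delta g x < +oo)%E ->
  exists2 Lam : R, 0 < Lam &
    (forall x, cube a l x -> (Lam%:E <= hc_maximal delta g x)%E) /\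
    (forall s, 0 < s -> (H [set x | cube a l x /\ (s * Lam)%:E < hc_maximal delta g x]
        <= (weak_const / s * l `^ delta)%:E)%E).
Proof.
move=> l0 [x0 Mx0] [N [N0 Nfin]].
pose gg y := `|g y|%E.
pose L := ereal_sup [set hc_mean delta P gg | P in
   [set P | is_cube P /\ cube a l `<=` P]].
have LM x : cube a l x -> (L <= hc_maximal delta g x)%E.
  move=> ax; apply: ge_ereal_sup => _ [P [cP aP] <-]; apply: ereal_sup_ubound.
  by exists P => //; split=> //; exact: aP.
have Lmean c m : 0 < m -> cube a l `<=` cube c m -> (hc_mean delta (cube c m) gg <= L)%E.
  by move=> m0 sub; apply: ereal_sup_ubound; exists (cube c m) => //; split=> //; exists c, m.
have Loo : (L < +oo)%E.
  have [x [ax Nx]] : exists x, cube a l x /\ ~ N x.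
    apply: contrapT => h; have := hcontent_cube_ge delta_gt0 delta_le a l0.
    rewrite (@hcontent_null_sub _ _ delta _ N)//.
      by rewrite lee_fin leNgt mulr_gt0 ?kappa_gt0// powR_gt0.
    by move=> x ax; apply: contrapT => Nx; apply: h; exists x.
  exact: le_lt_trans (LM x ax) (Nfin x Nx).
(* One positive mean passes to a cube that contains both its own cube and [cube a l]. *)
have L0 : (0 < L)%E.
  have [P [[b [r [r0 ->]]] mP]] : exists P, is_cube P /\ (0 < hc_mean delta P gg)%E.
    apply: contrapT => h; apply: Mx0; apply/eqP; rewrite eq_le; apply/andP; split.
      apply: ge_ereal_sup => _ [P [cP _] <-]; rewrite leNgt; apply/negP => mP.
      by apply: h; exists P.
    apply: (@le_trans _ _ (hc_mean delta (cube (x0 - const_mx 1) 1) gg)).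
      exact: hc_mean_ge0.
    apply: ereal_sup_ubound; exists (cube (x0 - const_mx 1) 1) => //; split.
      by exists (x0 - const_mx 1), 1.
    by move=> i; rewrite !mxE; apply/andP; split; lra.
  have [c [m [m0 [am bm]]]] := cube_union a b l0 r0.
  apply: lt_le_trans (Lmean c m m0 am).
  have [h hE [h0 _]] := hcontent_cube c m0.
  rewrite /hc_mean hE inver gt_eqF// mule_gt0 ?lte_fin ?invr_gt0//.
  apply: lt_le_trans (le_choquet (hcontent0 delta) bm (fun x _ _ => lexx _)).
  move: mP; have [k kE [k0 _]] := hcontent_cube b r0.
  by rewrite /hc_mean kE inver gt_eqF// pmule_rgt0// lte_fin invr_gt0.
have Lfin : L \is a fin_num by rewrite ge0_fin_numE// ltW.
pose Lam := fine L; have LE : L = Lam%:E by rewrite fineK.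
have Lam0 : 0 < Lam by rewrite -lte_fin -LE.
exists Lam => //; rewrite -LE; split=> // s s0.
have k0 := kappa_gt0 delta; have pk0 := @packing_const_gt0 R n delta.
have p2 : 0 < (2 `^ delta : R) by rewrite powR_gt0.
have p3 : 0 < (3 `^ delta : R) by rewrite powR_gt0.
have pl : 0 < l `^ delta by rewrite powR_gt0.
have n2 : 0 < (2 ^ n)%:R :> R by rewrite ltr0n expn_gt0.
have [sC|Cs] := leP s (3 `^ delta / kappa delta).
  apply: (@le_trans _ _ (l `^ delta)%:E).
    by apply: le_trans (hcontent_cube_le delta a l0); apply: le_hcontent => x [].
  rewrite lee_fin -[leLHS]mul1r ler_pM2r// ler_pdivlMr// mul1r.
  apply: le_trans sC _; rewrite lerDl ltW// ?mulr_gt0 ?invr_gt0//.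
pose q := a - const_mx l.
have l3 : 0 < 3 * l by lra.
(* When a cube of mean above [s * Lam] is covered by [2 ^ n] nodes, one of them receives an equal
   share of the integral; [c] is this share relative to the largest possible weight of the node. *)
pose c := s * Lam * kappa delta / (2 `^ delta * (2 ^ n)%:R).
have c0 : 0 < c by rewrite divr_gt0 ?mulr_gt0.
pose B := @packing_const R n delta * (Lam * (3 * l) `^ delta) / c.
have aq : cube a l `<=` cube q (3 * l).
  by move=> x ax i; have /andP[? ?] := ax i; rewrite !mxE; apply/andP; split; lra.
have chq : (choquet delta (cube q (3 * l)) gg <= (Lam * (3 * l) `^ delta)%:E)%E.
  by apply: choquet_le_mean => //; [exact: ltW|rewrite -LE; exact: Lmean].
have [|Cov [C1 C2 C3]] := @dyadic_covering R n delta q (3 * l) delta_gt0 l3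
  (fun P => choquet delta (nset (cube q (3 * l)) (code q (3 * l)) P) gg) c B c0.
  move=> t ut dt pt; apply: le_trans (packed_choquet delta_gt0 l3 gg ut dt pt) _.
  rewrite [(c * B)%R]mulrC /B divfK ?gt_eqF// [leRHS]EFinM lee_wpmul2l//.
  by rewrite lee_fin ltW.
set ns := nset _ _ in C1 C2.
have incl : [set x | cube a l x /\ ((s * Lam)%:E < hc_maximal delta g x)%E] `<=`
    \bigcup_(Q in Cov) cube (corner q (3 * l) Q - const_mx (side (3 * l) Q.1))
       (3 * side (3 * l) Q.1).
  move=> x [ax]; rewrite /hc_maximal => /ereal_sup_gt[_ [P [[b [r [r0 ->]]] bx] <-]] mP.
  have mP' := choquet_gt_mean r0 (ltW (mulr_gt0 s0 Lam0)) mP.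
  have pr : 0 < r `^ delta by rewrite powR_gt0.
  (* The triple of a larger cube would contain [cube a l] and hence have mean at most [Lam], too
     little for the present [s]. *)
  have rl : r <= l.
    rewrite leNgt; apply/negP => lr.
    have r3 : 0 < 3 * r by lra.
    have sub : cube a l `<=` cube (b - const_mx r) (3 * r).
      move=> y ay i; have /andP[? ?] := ay i; have /andP[? ?] := ax i.
      have /andP[? ?] := bx i; rewrite !mxE; apply/andP; split; lra.
    have sub' : cube b r `<=` cube (b - const_mx r) (3 * r).
      by move=> y by_ i; have /andP[? ?] := by_ i; rewrite !mxE; apply/andP; split; lra.
    have := choquet_le_mean r3 (ltW Lam0).
    rewrite -LE => /(_ _ _ (Lmean _ _ r3 sub)) le3.
    have := le_trans (le_choquet (hcontent0 delta) sub' (fun x _ _ => lexx (gg x))) le3.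
    rewrite leNgt; apply/negP/negPn; apply: le_lt_trans mP'.
    rewrite lee_fin powRM ?(ltW r0)// mulrA ler_pM2r// [s * Lam]mulrC -mulrA ler_pM2l//.
    by rewrite -ler_pdivrMr// ltW.
  have [Nd [N1 N2 N3]] := cover_by_nodes q delta_gt0 l3 b r0.
  have {}N2 := N2 (le_trans rl _).
  have bq : cube b r `<=` cube q (3 * l).
    move=> y by_ i; have /andP[? ?] := by_ i; have /andP[? ?] := ax i.
    have /andP[? ?] := bx i; rewrite !mxE; apply/andP; split; lra.
  have [e he] : exists e, ((s * Lam * kappa delta * r `^ delta / (2 ^ n)%:R)%:E <=
      choquet delta (ns (Nd e) `&` cube b r) gg)%E.
    apply: contrapT => h; move: mP'; apply/negP; rewrite -leNgt.
    apply: le_trans (@choquet_big _ _ delta _ (fun e => ns (Nd e) `&` cube b r) _ gg _) _.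
      by move=> y by_; have [e Ne] := N3 y (bq _ by_) by_; exists e.
    apply: (@le_trans _ _ (\sum_(e : {ffun 'I_n -> bool})
        (s * Lam * kappa delta * r `^ delta / (2 ^ n)%:R)%:E)%E).
      apply: lee_sum => e _; rewrite leNgt; apply/negP => /ltW he; apply: h.
      by exists e.
    rewrite sumEFin sumr_const card_ffun card_bool card_ord lee_fin.
    by rewrite -[leLHS]mulr_natr divfK// gt_eqF.
  have [y [Ny by_]] : ns (Nd e) `&` cube b r !=set0.
    apply/set0P/negP => /eqP E; move: he; rewrite E choquet0_set lee_fin leNgt.
    by rewrite !mulr_gt0 ?invr_gt0.
  have [||Q CQ [lev NQ]] := C2 (Nd e) y; [|exact: Ny|].
    rewrite /=; apply: (le_trans _ (le_trans he _)); last first.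
      by apply: (le_choquet (hcontent0 delta)) => // z [].
    rewrite lee_fin [leRHS](_ : _ = c * (2 `^ delta * r `^ delta)); last first.
      by rewrite /c; field; rewrite !gt_eqF.
    by rewrite ler_pM2l.
  (* The node contains a point [y] of the small cube but perhaps not [x]; since the edge of that
     cube is at most the side of [Q], tripling captures [x]. *)
  exists Q => // i.
  have := nset_sub_cube l3 (NQ _ Ny) i; have /andP[? ?] := bx i; have /andP[? ?] := by_ i.
  have rs : r <= side (3 * l) Q.1.
    apply: le_trans (N2 _ e) _; first lra.
    by apply: rho_le lev => j; rewrite (sideS (3 * l) j); have := side_gt0 l3 j.+1; lra.
  rewrite !mxE; move: (side _ _) rs => sd rs /andP[? ?]; apply/andP; split; lra.
apply: le_trans (hcontent_le_cover delta _ incl) _.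
  by move=> Q _; rewrite mulr_gt0// side_gt0.
apply: (@le_trans _ _ (\esum_(Q in Cov) (3 `^ delta * rho delta (3 * l) Q.1)%:E)%E).
  by apply: le_esum => Q _; rewrite lee_fin powRM ?(ltW (side_gt0 l3 _)).
apply: le_trans (esumZl_le _ (ltW p3) _) _; first by move=> Q; rewrite powR_ge0.
apply: (@le_trans _ _ ((3 `^ delta)%:E * B%:E)%E); first by rewrite lee_wpmul2l// lee_fin ltW.
rewrite -EFinM lee_fin /B powRM ?(ltW l0)//.
set p := packing_const _; set w := 3 `^ delta * (p * 3 `^ delta * (2 `^ delta * (2 ^ n)%:R) / kappa delta).
apply: (@le_trans _ _ (w / s * l `^ delta)).
  rewrite le_eqVlt; apply/orP; left; apply/eqP.
  by rewrite /w /c; field; rewrite !gt_eqF.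
rewrite ler_pM2r// ler_pM2r ?invr_gt0// /weak_const -/p -/w lerDr.
by rewrite ltW// mulr_gt0 ?invr_gt0.
Qed.

End Mean.

(** * Logarithms of maximal functions *)

Section Converse.
Context {R : realType} {n : nat}.
Variable delta : R.
Hypothesis delta_gt0 : 0 < delta.
Hypothesis delta_le : delta <= n%:R.
Local Notation H := (@hcontent R n delta).
Local Notation cube := (@cube R n).
Implicit Types (f g : 'rV[R]_n -> \bar R).

Lemma compact_sub_cube (K : set 'rV[R]_n) : compact K ->
  exists a l, 0 < l /\ K `<=` cube a l.
Proof.
move=> /compact_bounded[M [_ KM]].
have {}KM x : K x -> `|x| <= `|M| + 1.
  by move=> Kx; apply: KM => //; apply: le_lt_trans (ler_norm _) _; rewrite ltrDl.
have M0 := normr_ge0 M.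
exists (const_mx (- (`|M| + 2))), (2 * (`|M| + 2)); split; first lra.
move=> x /KM xM i; rewrite mxE.
have : `|x ord0 i| <= `|x|.
  rewrite [leRHS]mx_normrE; exact: (le_bigmax 0 (fun ij : 'I_1 * 'I_n => `|x ij.1 ij.2|) (ord0, i)).
by rewrite ler_norml => /andP[? ?]; apply/andP; split; lra.
Qed.

(** The square of [1 + y <= expR y] at [y = t / (6 * T)]. *)
Lemma expRN_le_tail (t T : R) : 0 < T -> 0 <= t ->
  expR (- (t / (3 * T))) <= 36 * (T ^+ 2 / (T + t) ^+ 2).
Proof.
move=> T0 t0; have T3 : 0 < 3 * T by lra.
have y0 : 0 <= t / (6 * T) by rewrite divr_ge0//; lra.
have -> : t / (3 * T) = t / (6 * T) + t / (6 * T) by field; lra.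
rewrite expRN expRD -expr2.
have h : (T + t) / (6 * T) <= expR (t / (6 * T)).
  apply: le_trans (expR_ge1Dx _); rewrite mulrDl lerD2r.
  by rewrite ler_pdivrMr; lra.
have h0 : 0 < (T + t) / (6 * T) by rewrite divr_gt0; lra.
have -> : 36 * (T ^+ 2 / (T + t) ^+ 2) = (((T + t) / (6 * T)) ^+ 2)^-1.
  by field; rewrite !gt_eqF//; lra.
rewrite lef_pV2 ?posrE ?exprn_gt0 ?expR_gt0//.
by apply: lerXn2r; rewrite ?nnegrE ?expR_ge0// ltW.
Qed.

(** One [weak_const] for each maximal function; [expR 1] serves for [t < 3 * B], where the
    exponential factor is at least [expR (- 1)]. *)
Definition tail_const : R := 2 * @weak_const R n delta + expR 1.

Lemma tail_const_ge : expR 1 <= tail_const.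
Proof. by rewrite lerDr mulr_ge0// ltW// weak_const_gt0. Qed.

Lemma tail_const_gt0 : 0 < tail_const.
Proof. exact: lt_le_trans (expR_gt0 1) tail_const_ge. Qed.

Section LogDifference.
Variables (alpha beta B : R) (b g1 g2 : 'rV[R]_n -> \bar R).
Hypothesis (alpha_gt0 : 0 < alpha) (beta_gt0 : 0 < beta) (B_gt0 : 0 < B).
Hypothesis b_bounded : H [set x | (B%:E < `|b x|)%E] = 0%E.
Hypothesis g1_neq0 : exists x, hc_maximal delta g1 x <> 0%E.
Hypothesis g2_neq0 : exists x, hc_maximal delta g2 x <> 0%E.
Hypothesis g1_fin : hc_ae delta (fun x => hc_maximal delta g1 x < +oo)%E.
Hypothesis g2_fin : hc_ae delta (fun x => hc_maximal delta g2 x < +oo)%E.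
Let f := log_maximal_diff delta alpha beta g1 g2 b.
Let T := alpha + beta + B.

Let T_gt0 : 0 < T. Proof. by rewrite !addr_gt0. Qed.
Let alpha_le : alpha <= T. Proof. by rewrite /T -addrA lerDl addr_ge0// ltW. Qed.
Let beta_le : beta <= T. Proof. by rewrite /T addrAC lerDr addr_ge0// ltW. Qed.
Let B_le : B <= T. Proof. by rewrite /T lerDr addr_ge0// ltW. Qed.

Lemma log_ratio_gt (gam m Lam t : R) : 0 < gam -> gam <= T -> 0 < Lam -> 0 <= t -> Lam <= m ->
  t / 3 < gam * (ln m - ln Lam) -> expR (t / (3 * T)) * Lam < m.
Proof.
move=> gam0 gamT Lam0 t0 Lm lt.
have m0 : 0 < m by exact: lt_le_trans Lm.
have T0 : 0 < T by exact: lt_le_trans gamT.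
rewrite -ltr_pdivlMr// -[X in _ < X]lnK ?posrE ?divr_gt0// ltr_expR.
rewrite ln_div ?posrE//.
apply: (@le_lt_trans _ _ (t / 3 / gam)); last first.
  by rewrite ltr_pdivrMr// [X in _ < X]mulrC.
by rewrite invfM mulrA ler_wpM2l ?divr_ge0// lef_pV2 ?posrE.
Qed.

Lemma log_difference_tail a (l : R) : 0 < l -> exists c : R, forall t : R,
  (H [set x | cube a l x /\ (t%:E < `|f x - c%:E|)%E]
     <= (tail_const * expR (- (t / (3 * T))) * l `^ delta)%:E)%E.
Proof.
move=> l0.
have T0 := T_gt0; have BT := B_le; have B0 := B_gt0.
have [L1 L10 [L1le H1]] := maximal_level_estimate delta_gt0 delta_le a l0 g1_neq0 g1_fin.
have [L2 L20 [L2le H2]] := maximal_level_estimate delta_gt0 delta_le a l0 g2_neq0 g2_fin.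
(* With this constant both logarithmic differences are nonnegative on the cube, because [L1] and
   [L2] are lower bounds there. *)
exists (alpha * ln L1 - beta * ln L2) => t; set c := _ - _.
have pl : 0 < l `^ delta by rewrite powR_gt0.
have Hl (A : set 'rV[R]_n) : A `<=` cube a l -> (H A <= (l `^ delta)%:E)%E.
  by move=> Al; apply: le_trans (hcontent_cube_le delta a l0); exact: le_hcontent.
have [tB|Bt] := ltP t (3 * B).
  apply: le_trans (Hl _ _) _; first by move=> x [].
  rewrite lee_fin -[leLHS]mul1r ler_pM2r//.
  apply: le_trans (ler_wpM2r (expR_ge0 _) tail_const_ge).
  rewrite -expRD -[leLHS]expR0 ler_expR subr_ge0 ler_pdivrMr ?mul1r; last lra.
  lra.
have t0 : 0 <= t by lra.
have [[N1 [N10 F1]] [N2 [N20 F2]]] := (g1_fin, g2_fin).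
set E := expR (t / (3 * T)); have E0 : 0 < E by exact: expR_gt0.
(* One of three terms must exceed [t / 3], and outside the null sets it is not [b]. Discarding
   infinite values there also avoids the default value of the sum. *)
have incl : [set x | cube a l x /\ (t%:E < `|f x - c%:E|)%E] `<=`
   ([set x | cube a l x /\ ((E * L1)%:E < hc_maximal delta g1 x)%E] `|`
    [set x | cube a l x /\ ((E * L2)%:E < hc_maximal delta g2 x)%E]) `|`
   ((N1 `|` N2) `|` [set x | (B%:E < `|b x|)%E]).
  move=> x [ax tf].
  have [Nx|Nx] := pselect ((N1 `|` N2) x); first by right; left.
  have [bx|] := boolP (B%:E < `|b x|)%E; first by right; right.
  rewrite -leNgt => bB; left.
  have N1x : ~ N1 x by move=> ?; apply: Nx; left.
  have N2x : ~ N2 x by move=> ?; apply: Nx; right.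
  have := F1 x N1x; have := L1le x ax; have := F2 x N2x; have := L2le x ax.
  move: tf; rewrite /f /log_maximal_diff.
  case M2 : (hc_maximal delta g2 x) => [m2| |]// tf; rewrite lee_fin => L2m _.
  case M1 : (hc_maximal delta g1 x) tf => [m1| |]// tf; rewrite lee_fin => L1m _.
  have m10 : 0 < m1 by exact: lt_le_trans L1m.
  have m20 : 0 < m2 by exact: lt_le_trans L2m.
  move: bB tf; case: (b x) => [bx| |]//; rewrite lee_fin => bB.
  rewrite !lne_EFin// -!EFinM -EFinN -!EFinD /= lte_fin => tf.
  have [lt1|le1] := ltP (t / 3) (alpha * (ln m1 - ln L1)).
    by left; split=> //; rewrite M1 lte_fin; exact: log_ratio_gt lt1.
  have [lt2|le2] := ltP (t / 3) (beta * (ln m2 - ln L2)).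
    by right; split=> //; rewrite M2 lte_fin; exact: log_ratio_gt lt2.
  exfalso; move: tf; apply/negP; rewrite -leNgt.
  have p1 : 0 <= alpha * (ln m1 - ln L1) by rewrite mulr_ge0 ?(ltW alpha_gt0)// subr_ge0 ler_ln ?posrE.
  have p2 : 0 <= beta * (ln m2 - ln L2) by rewrite mulr_ge0 ?(ltW beta_gt0)// subr_ge0 ler_ln ?posrE.
  move: bB; rewrite ler_norml => /andP[? ?].
  by rewrite ler_norml /c; apply/andP; split; lra.
apply: le_trans (le_hcontent delta incl) _.
rewrite hcontentUnull; last first.
  apply: (@hcontent_null_bigcup _ _ delta 'I_3
    (fun i => if i == 0 then N1 else if i == 1 then N2 else [set x | (B%:E < `|b x|)%E])).
    by move=> i; case: eqP => // _; case: eqP.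
  move=> x [[|]|] Nx; [exists (inord 0)|exists (inord 1)|exists (inord 2)] => //=;
  by rewrite -!(inj_eq val_inj)/= !inordK.
apply: le_trans (hcontentU _ _ _) _.
apply: le_trans (leeD (H1 E E0) (H2 E E0)) _.
rewrite -EFinD lee_fin expRN -/E; set W := weak_const _.
have -> : W / E * l `^ delta + W / E * l `^ delta = 2 * W / E * l `^ delta by ring.
by rewrite ler_pM2r// ler_pM2r ?invr_gt0// lerDl expR_ge0.
Qed.

(** The slack [d] lets one bound serve twice: it is 0 for the oscillation about [c], and the
    absolute value of [c] for the local integrability of [f] itself. *)
Lemma log_difference_choquet A a (l c d : R) (h : 'rV[R]_n -> \bar R) : 0 < l ->
  A `<=` cube a l -> 0 <= d ->
  (forall t : R, (H [set x | cube a l x /\ (t%:E < `|f x - c%:E|)%E]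
     <= (tail_const * expR (- (t / (3 * T))) * l `^ delta)%:E)%E) ->
  (forall x, (`|h x| <= `|f x - c%:E| + d%:E)%E) ->
  (choquet delta A (fun x => `|h x|%E) <=
    (36 * tail_const * expR (d / (3 * T)) * T * l `^ delta)%:E)%E.
Proof.
move=> l0 Aa d0 tail hf.
have T0 := T_gt0; have BT := B_le; have B0 := B_gt0.
have pl : 0 < l `^ delta by rewrite powR_gt0.
have c0 := tail_const_gt0.
have -> : 36 * tail_const * expR (d / (3 * T)) * T * l `^ delta =
  (36 * tail_const * expR (d / (3 * T)) * l `^ delta) * T by ring.
apply: choquet_le_tail => //.
  by rewrite !mulr_ge0 ?expR_ge0// ltW.
move=> t t0; apply: (@le_trans _ _ (H [set x | cube a l x /\ ((t - d)%:E < `|f x - c%:E|)%E])).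
  apply: le_hcontent => x [Ax tx]; split; first exact: Aa.
  rewrite EFinB lteBlDr//; exact: lt_le_trans tx (hf x).
apply: le_trans (tail _) _.
rewrite lee_fin [leRHS]mulrAC ler_pM2r//.
have -> : - ((t - d) / (3 * T)) = d / (3 * T) + - (t / (3 * T)) by field; lra.
rewrite expRD mulrA; set E := expR (d / _); set X := T ^+ 2 / _.
have -> : 36 * tail_const * E * X = tail_const * E * (36 * X) by ring.
rewrite ler_pM2l ?mulr_gt0 ?expR_gt0//.
by apply: expRN_le_tail => //; exact: ltW.
Qed.

End LogDifference.

Definition converse_const : R := 72 * tail_const / kappa delta.

Lemma converse_const_gt0 : 0 < converse_const.
Proof. by rewrite divr_gt0 ?kappa_gt0// mulr_gt0// tail_const_gt0. Qed.

Lemma hc_Linfty_norm_ge0 f : (0 <= hc_Linfty_norm delta f)%E.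
Proof.
by apply: le_ereal_inf_tmp => _ [t [t0 _] <-]; rewrite lee_fin ltW.
Qed.

Lemma log_maximal_diff_BMO (alpha beta : R) (b g1 g2 : 'rV[R]_n -> \bar R) :
  0 < alpha -> 0 < beta -> hc_Linfty delta b ->
  (exists x, hc_maximal delta g1 x <> 0%E) ->
  (exists x, hc_maximal delta g2 x <> 0%E) ->
  hc_ae delta (fun x => hc_maximal delta g1 x < +oo)%E ->
  hc_ae delta (fun x => hc_maximal delta g2 x < +oo)%E ->
  let f := log_maximal_diff delta alpha beta g1 g2 b in
  hc_BMO delta f /\
  (hc_BMO_norm delta f <=
    converse_const%:E * ((alpha + beta)%:E + hc_Linfty_norm delta b))%E.
Proof.
move=> a0 b0 bfin nz1 nz2 f1 f2 f.
have nfin : hc_Linfty_norm delta b \is a fin_num.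
  by rewrite ge0_fin_numE ?hc_Linfty_norm_ge0.
pose nb := fine (hc_Linfty_norm delta b); have nbE : hc_Linfty_norm delta b = nb%:E by rewrite fineK.
have nb0 : 0 <= nb by rewrite -lee_fin -nbE hc_Linfty_norm_ge0.
(* An admissible bound within [alpha] of the norm of [b] keeps [alpha + beta + B] below twice the
   sum in the claim; hence [72 = 2 * 36]. *)
have [_ [B [B0 bB] <-]] := lb_ereal_inf_adherent a0 nfin.
rewrite -/(hc_Linfty_norm delta b) nbE -EFinD lte_fin => Bnb.
have T0 : 0 < alpha + beta + B by rewrite !addr_gt0.
have tail := log_difference_tail a0 b0 B0 bB nz1 nz2 f1 f2.
have norm : (hc_BMO_norm delta f <= (converse_const * (alpha + beta + nb))%:E)%E.
  apply: ge_ereal_sup => _ [_ [a [l [l0 ->]]] <-].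
  have [c ct] := tail a l l0.
  apply: (@le_trans _ _ (hc_mean delta (cube a l) (fun x => `|f x - c%:E|%E))).
    by apply: ereal_inf_lbound; exists c.
  have bound := @log_difference_choquet alpha beta B b g1 g2 a0 b0 B0 (cube a l) a l c 0
    (fun x => f x - c%:E)%E l0 (fun x h => h) (lexx _) ct.
  apply: le_trans (hc_mean_le delta_gt0 delta_le l0 _ (bound _)) _.
  - by rewrite !mulr_ge0 ?expR_ge0 ?(ltW tail_const_gt0)// ltW.
  - by move=> x; rewrite adde0.
  rewrite lee_fin mul0r expR0 mulr1 /converse_const [leRHS]mulrAC ler_pM2r ?invr_gt0 ?kappa_gt0//.
  have -> : 72 * tail_const * (alpha + beta + nb) = 36 * tail_const * (2 * (alpha + beta + nb)) by ring.
  by rewrite ler_pM2l ?mulr_gt0 ?tail_const_gt0//; lra.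
split; last by rewrite -EFinD -EFinM.
split; last exact: le_lt_trans norm (ltry _).
move=> K /compact_sub_cube[a [l [l0 Kl]]]; have [c ct] := tail a l l0.
apply: le_lt_trans (@log_difference_choquet alpha beta B b g1 g2 a0 b0 B0 K a l c `|c|
  f l0 Kl (normr_ge0 _) ct _) (ltry _).
move=> x; rewrite -/f; case: (f x) => [y| |]//=.
by rewrite lee_fin; apply: le_trans (ler_normD _ _); rewrite subrK.
Qed.

End Converse.

(** * Play operator *)

(* [play] follows the path [p] with clearance [W]; [up] is the total amount by
   which it is pushed upwards. The downward amount is the [up] of [- p]. *)
Section Play.
Context {R : realType}.
Variable W : R.
Hypothesis W_ge0 : 0 <= W.
Implicit Types (p q : nat -> R) (z v : R).

Definition clamp v : R := Num.max (- W) (Num.min v W).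
Definition excess v : R := Num.max 0 (v - W).

Fixpoint play p z (i : nat) : R :=
  if i is j.+1 then clamp (play p z j + (p j.+1 - p j)) else z.

Fixpoint up p z (i : nat) : R :=
  if i is j.+1 then up p z j + excess (play p z j + (p j.+1 - p j)) else 0.

Lemma clamp_cases v :
  [\/ [/\ v <= - W, clamp v = - W & excess v = 0],
      [/\ - W <= v, v <= W, clamp v = v & excess v = 0] |
      [/\ W <= v, clamp v = W & excess v = v - W]].
Proof.
have W0 := W_ge0; rewrite /clamp /excess.
have [vW|/ltW Wv] := leP v W; last first.
  by apply: Or33; split=> //; rewrite max_r//; lra.
have v0 : Num.max 0 (v - W) = 0 by rewrite max_l// subr_le0.
have [vNW|/ltW NWv] := leP v (- W).
  by apply: Or31; split=> //; rewrite max_l.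
by apply: Or32; split=> //; rewrite max_r.
Qed.

Lemma clampN v : clamp (- v) = - clamp v.
Proof.
have W0 := W_ge0.
by case: (clamp_cases v) => [[? -> _]|[? ? -> _]|[? -> _]];
  case: (clamp_cases (- v)) => [[? -> _]|[? ? -> _]|[? -> _]]; lra.
Qed.

Lemma clamp_excess v : v = clamp v + excess v - excess (- v).
Proof.
have W0 := W_ge0.
by case: (clamp_cases v) => [[? -> ->]|[? ? -> ->]|[? -> ->]];
  case: (clamp_cases (- v)) => [[? _ ->]|[? ? _ ->]|[? _ ->]]; lra.
Qed.

(* [clamp] and the two excesses are monotone and sum to the identity. *)
Lemma excess_clamp_dist v w :
  `|excess v - excess w| + `|clamp v - clamp w| <= `|v - w|.
Proof.
have W0 := W_ge0; wlog vw : v w / w <= v => [hw|].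
  have [|/ltW] := leP w v; first exact: hw.
  by move=> /hw; rewrite (distrC (excess v)) (distrC (clamp v)) (distrC v).
rewrite [leRHS]ger0_norm ?subr_ge0//.
by case: (clamp_cases v) => [[? -> ->]|[? ? -> ->]|[? -> ->]];
  case: (clamp_cases w) => [[? -> ->]|[? ? -> ->]|[? -> ->]];
  rewrite !ger0_norm; lra.
Qed.

Lemma clamp_bound v : `|clamp v| <= W.
Proof.
have W0 := W_ge0; rewrite ler_norml.
by case: (clamp_cases v) => [[? -> _]|[? ? -> _]|[? -> _]]; apply/andP; split; lra.
Qed.

Lemma excess_ge0 v : 0 <= excess v.
Proof. by rewrite le_max lexx. Qed.

Lemma play_bound p z i : `|z| <= W -> `|play p z i| <= W.
Proof. by case: i => [|i] // _; exact: clamp_bound. Qed.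

Lemma playN p z i : play (fun j => - p j) (- z) i = - play p z i.
Proof. by elim: i => //= i ->; rewrite -clampN; congr clamp; lra. Qed.

(** [play] is the offset of the path from its follower, and the follower moves by rise minus fall.
    Boundedness of the offset makes this the displacement up to the clearance. *)
Lemma play_up_down p z i :
  p i - p 0%N = play p z i - z + up p z i - up (fun j => - p j) (- z) i.
Proof.
elim: i => [|i IH] /=; first by rewrite !subrr addr0 subr0.
rewrite playN.
have -> : - play p z i + (- p i.+1 - - p i) = - (play p z i + (p i.+1 - p i)) by lra.
have := clamp_excess (play p z i + (p i.+1 - p i)).
by set v := play p z i + _; move: (clamp v) (excess v) (excess (- v)) => c e e'; rewrite /v; lra.
Qed.

(** Rise and offset are compared jointly: by [excess_clamp_dist] a step may move distance from one
    to the other, but only the difference of the increments adds to it. *)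
Lemma up_play_dist p q z w i :
  `|up p z i - up q w i| + `|play p z i - play q w i| <=
  `|z - w| + \sum_(m < i) `|(p m.+1 - p m) - (q m.+1 - q m)|.
Proof.
elim: i => [|i IH] /=; first by rewrite big_ord0 subrr normr0 add0r addr0.
rewrite big_ord_recr/= [leRHS]addrA.
set v := play p z i + _; set v' := play q w i + _.
have := excess_clamp_dist v v'.
have : `|v - v'| <= `|play p z i - play q w i| + `|p i.+1 - p i - (q i.+1 - q i)|.
  have -> : v - v' = (play p z i - play q w i) + (p i.+1 - p i - (q i.+1 - q i)).
    by rewrite /v /v'; ring.
  exact: ler_normD.
have : `|up p z i + excess v - (up q w i + excess v')| <=
    `|up p z i - up q w i| + `|excess v - excess v'|.
  have -> : up p z i + excess v - (up q w i + excess v') =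
    (up p z i - up q w i) + (excess v - excess v') by ring.
  exact: ler_normD.
by move: IH; lra.
Qed.

Lemma up_start_dist p z w i : `|up p z i - up p w i| <= `|z - w|.
Proof.
have := up_play_dist p p z w i; rewrite big1 ?addr0 => [|m _]; last by rewrite subrr normr0.
by apply: le_trans; rewrite lerDl.
Qed.

Lemma up_path_dist p q z i :
  `|up p z i - up q z i| <= \sum_(m < i) `|(p m.+1 - p m) - (q m.+1 - q m)|.
Proof.
have := up_play_dist p q z z i; rewrite subrr normr0 add0r.
by apply: le_trans; rewrite lerDl.
Qed.

Lemma up_mono p z i j : (i <= j)%N -> up p z i <= up p z j.
Proof.
elim: j => [|j IH]; first by rewrite leqn0 => /eqP->.
rewrite leq_eqVlt => /predU1P[->//|/IH le] /=; apply: le_trans le _.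
by rewrite lerDl excess_ge0.
Qed.

Lemma up_ge0 p z i : 0 <= up p z i.
Proof. exact: (@up_mono p z 0). Qed.

Lemma up_small p i : (forall j, (j <= i)%N -> `|p j - p 0%N| <= W) ->
  up p 0 i = 0 /\ play p 0 i = p i - p 0%N.
Proof.
elim: i => [|i IH] small /=; first by rewrite subrr.
have [|up0 pl] := IH; first by move=> j ji; apply: small; exact: leqW.
rewrite pl.
have := small i.+1 (leqnn _); rewrite ler_norml => /andP[? ?].
have -> : p i - p 0%N + (p i.+1 - p i) = p i.+1 - p 0%N by lra.
rewrite up0 /excess /clamp add0r; split; first by apply/max_idPl; lra.
by rewrite min_l// max_r.
Qed.

Lemma play_cat p z i m :
  play p z (i + m) = play (fun j => p (i + j)%N) (play p z i) m.
Proof.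
elim: m => [|m IH]; first by rewrite addn0.
by rewrite addnS /= IH addnS.
Qed.

Lemma up_cat p z i m :
  up p z (i + m) = up p z i + up (fun j => p (i + j)%N) (play p z i) m.
Proof.
elim: m => [|m IH]; first by rewrite addn0 /= addr0.
by rewrite addnS /= IH play_cat addnS -addrA.
Qed.

(** Restarting with offset 0 replaces an inherited offset of size at most [W]. *)
Lemma up_cat_dist p i m :
  `|up p 0 (i + m) - up p 0 i - up (fun j => p (i + j)%N) 0 m| <= W.
Proof.
rewrite up_cat [_ + up _ _ m]addrC addrK; apply: le_trans (up_start_dist _ _ _ _) _.
by rewrite subr0 play_bound// normr0.
Qed.

End Play.

(** * Variation across scales *)

Section Scales.
Context {R : realType}.

Definition sc (k : int) : R := 2 ^ k.

Lemma sc_gt0 k : 0 < sc k. Proof. by rewrite exprz_gt0. Qed.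

Lemma scB k (j : nat) : sc (k - j%:Z) = sc k / 2 ^+ j.
Proof. by rewrite /sc expfzDr// -invr_expz. Qed.

Lemma scD k (j : nat) : sc (k + j%:Z) = sc k * 2 ^+ j.
Proof. by rewrite /sc expfzDr. Qed.

Lemma scS k : sc (k + 1) = 2 * sc k.
Proof. by rewrite (scD k 1) expr1 mulrC. Qed.

Lemma sc0 : sc 0 = 1. Proof. by rewrite /sc expr0z. Qed.

Lemma sc_nat (k : nat) : sc k%:Z = 2 ^+ k. Proof. by []. Qed.

Lemma sc_le j k : j <= k -> sc j <= sc k.
Proof. by move=> jk; rewrite /sc ler_weXz2l // ler1n. Qed.

Lemma sc_lt_inv j k : sc j < sc k -> j < k.
Proof. by move=> h; rewrite ltNge; apply/negP => /sc_le; rewrite leNgt h. Qed.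

Lemma sc_exists (r : R) : 0 < r -> exists k : int, sc (k - 1) < r /\ r <= sc k.
Proof.
move=> r0.
have big (y : R) : exists j : nat, y < 2 ^+ j.
  exists (Num.truncn y).+1; apply: lt_le_trans (truncnS_gt y) _.
  by rewrite -natrX ler_nat ltnW// ltn_expl.
have [i ri] := big r^-1.
have scir : sc (- i%:Z) < r.
  by rewrite -[- _]add0r scB sc0 mul1r invf_plt ?posrE ?exprn_gt0.
have ex : exists t : nat, r <= sc (t%:Z - i%:Z).
  have [j rj] := big (r * 2 ^+ i); exists j.
  by rewrite scB sc_nat ler_pdivlMr ?exprn_gt0// ltW.
case: (ex_minnP ex) => t rt tmin; exists (t%:Z - i%:Z); split=> //.
case: t rt tmin => [|t] rt tmin; first by move: scir; rewrite ltNge -[- i%:Z]add0r rt.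
rewrite ltNge; apply/negP => h; have := tmin t; rewrite ltnn => /(_ _)/negP; apply => //.
apply: le_trans h _; rewrite le_eqVlt; apply/orP; left; apply/eqP; congr sc.
by rewrite -addn1 PoszD; lia.
Qed.

End Scales.

Section Norm.
Context {R : realType} {n : nat}.

Lemma le_coord_norm (x : 'rV[R]_n) i : `|x ord0 i| <= `|x|.
Proof.
rewrite [leRHS]mx_normrE.
exact: (le_bigmax 0 (fun ij : 'I_1 * 'I_n => `|x ij.1 ij.2|) (ord0, i)).
Qed.

Lemma norm_le_coord (x : 'rV[R]_n) (r : R) : 0 <= r ->
  (forall i, `|x ord0 i| <= r) -> `|x| <= r.
Proof.
move=> r0 xr; rewrite [leLHS]mx_normrE; apply/bigmax_leP; split=> // -[i j] _ /=.
by rewrite ord1.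
Qed.

Lemma cube_norm_le (b x : 'rV[R]_n) (r : R) : 0 < r -> cube b r x -> `|x - b| <= r.
Proof.
move=> r0 bx; apply: norm_le_coord; first exact: ltW.
by move=> i; have /andP[? ?] := bx i; rewrite !mxE ler_norml; apply/andP; split; lra.
Qed.

End Norm.

Section Variation.
Context {R : realType} {n : nat}.
Variables (a : int -> 'rV[R]_n -> R) (c0 W : R).

(** A Lipschitz bound at scale [sc (j + i)], recorded only at dyadic distances [sc j], the form in
    which it is summed over [i]. *)
Definition smooth_in_scale : Prop :=
  forall (j : int) (x y : 'rV[R]_n) (i : nat), `|x - y| <= sc j ->
    `|a (j + i%:Z) x - a (j + i%:Z) y| <= c0 / 2 ^+ i.

Hypothesis c0_ge0 : 0 <= c0.
Hypothesis W_gt0 : 0 < W.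
Hypothesis a_smooth : smooth_in_scale.

Definition path k x (i : nat) : R := a (k - i%:Z) x.
Definition upv k x (i : nat) : R := up W (path k x) 0 i.

Let W_ge0 : 0 <= W. Proof. exact: ltW. Qed.

Lemma path0 k x : path k x 0 = a k x.
Proof. by rewrite /path subr0. Qed.

Lemma path_shift k x j : (fun i => path k x (j + i)%N) = path (k - j%:Z) x.
Proof. by apply/funext => i; rewrite /path PoszD opprD addrA. Qed.

Lemma upv_mono k x i j : (i <= j)%N -> upv k x i <= upv k x j.
Proof. exact: up_mono. Qed.

Lemma upv_ge0 k x i : 0 <= upv k x i.
Proof. exact: up_ge0. Qed.

Lemma upv_cat k x j i : `|upv k x (j + i) - upv k x j - upv (k - j%:Z) x i| <= W.
Proof. by rewrite /upv -path_shift; exact: up_cat_dist. Qed.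

Lemma geometric_sum_le (N : nat) : \sum_(m < N) (2 ^+ m)^-1 <= 2 :> R.
Proof.
suff -> : \sum_(m < N) (2 ^+ m)^-1 = 2 - 2 / 2 ^+ N :> R by rewrite gerBl.
elim: N => [|N IH]; first by rewrite big_ord0 expr0 divr1 subrr.
rewrite big_ord_recr/= IH exprS; field.
by rewrite expf_neq0.
Qed.

(** Down to the scale of the distance, the increments of the two paths differ by amounts that decay
    geometrically from the finest scale upwards. *)
Lemma upv_dist k x y d : `|x - y| <= sc (k - d%:Z) -> `|upv k x d - upv k y d| <= 4 * c0.
Proof.
move=> xy; apply: le_trans (up_path_dist W_ge0 _ _ _ _) _.
have pd m : (m <= d)%N -> `|path k x m - path k y m| <= c0 / 2 ^+ (d - m).
  move=> md; rewrite /path; have := a_smooth (d - m)%N xy.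
  by rewrite (_ : k - d%:Z + (d - m)%N%:Z = k - m%:Z)//; lia.
apply: (@le_trans _ _ (\sum_(m < d) (2 * c0) / 2 ^+ (d - m.+1))).
  apply: ler_sum => m _.
  have -> : path k x m.+1 - path k x m - (path k y m.+1 - path k y m) =
    (path k x m.+1 - path k y m.+1) - (path k x m - path k y m) by ring.
  apply: le_trans (ler_normB _ _) _.
  apply: (le_trans (lerD (pd _ (ltn_ord m)) (pd _ (ltnW (ltn_ord m))))).
  have : c0 / 2 ^+ (d - m) <= c0 / 2 ^+ (d - m.+1).
    rewrite ler_wpM2l// lef_pV2 ?posrE ?exprn_gt0// ler_weXn2l ?ler1n//; lia.
  by rewrite -[2 * _ * _]mulrA; lra.
rewrite -mulr_sumr.
have -> : \sum_(m < d) (2 ^+ (d - m.+1))^-1 = \sum_(m < d) (2 ^+ m)^-1 :> R.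
  rewrite (reindex_inj rev_ord_inj)/=; apply: eq_bigr => m _.
  by congr (_ ^+ _)^-1; have := ltn_ord m; lia.
have := geometric_sum_le d; have : 0 <= 2 * c0 by rewrite mulr_ge0.
move=> h1 h2; apply: le_trans (ler_wpM2l h1 h2) _; lra.
Qed.

(** Starting at scale 0 is no restriction: by [upv_bounded], finite rise from there gives finite
    rise from every scale. *)
Definition bad : set 'rV[R]_n := [set x | forall M : R, exists i, M < upv 0 x i].

Lemma upv_bounded k x : ~ bad x -> exists M, forall i, upv k x i <= M.
Proof.
move=> /existsNP[M0 /forallNP M0P].
have {M0P} b0 i : upv 0 x i <= M0 by rewrite leNgt; apply/negP; exact: M0P.
case: k => j; last first.
  have -> : Negz j = 0 - j.+1%:Z by rewrite sub0r NegzE.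
  exists (M0 + W) => i; have := upv_cat 0 x j.+1 i; rewrite ler_norml => /andP[? _].
  by have := b0 (j.+1 + i)%N; have := upv_ge0 0 x j.+1; lra.
exists (upv j%:Z x j + M0 + W) => i; have := upv_cat j%:Z x j i.
rewrite subrr ler_norml => /andP[_ ?].
by have := b0 i; have := upv_mono j%:Z x (leq_addl j i); lra.
Qed.

Definition supv k x : R := sup (range (upv k x)).

Lemma upv_le_supv k x i : ~ bad x -> upv k x i <= supv k x.
Proof.
move=> nb; have [M Mub] := upv_bounded k nb.
by apply: ub_le_sup; [exists M => _ [j _ <-]|exists i].
Qed.

Lemma supv_le k x M : (forall i, upv k x i <= M) -> supv k x <= M.
Proof. by move=> h; apply: ge_sup; [exists (upv k x 0), 0%N|move=> _ [j _ <-]]. Qed.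

Lemma supv_ge0 k x : ~ bad x -> 0 <= supv k x.
Proof. by move=> nb; apply: le_trans (upv_le_supv k 0 nb); exact: upv_ge0. Qed.

Lemma supv_gt k x M : ~ bad x -> M < supv k x -> exists i, M < upv k x i.
Proof.
move=> nb Ms; apply: contrapT => /forallNP h; move: Ms; apply/negP.
by rewrite -leNgt; apply: supv_le => i; rewrite leNgt; apply/negP.
Qed.

Lemma upv_eventually k x : ~ bad x -> exists i0, forall i, (i0 <= i)%N ->
  supv k x - W <= upv k x i <= supv k x.
Proof.
move=> nb; have [i0 h0] : exists i, supv k x - W < upv k x i.
  by apply: supv_gt => //; rewrite ltrBlDr ltrDl.
exists i0 => i i0i; rewrite upv_le_supv// andbT.
by apply: le_trans (ltW h0) _; exact: upv_mono.
Qed.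

Lemma supv_cat k x j : ~ bad x -> `|supv k x - upv k x j - supv (k - j%:Z) x| <= W.
Proof.
move=> nb; rewrite ler_norml; apply/andP; split.
  suff : supv (k - j%:Z) x <= supv k x - upv k x j + W by lra.
  apply: supv_le => i; have := upv_cat k x j i; rewrite ler_norml => /andP[? _].
  by have := upv_le_supv k (j + i) nb; lra.
suff : supv k x <= upv k x j + supv (k - j%:Z) x + W by lra.
apply: supv_le => i; have := upv_cat k x j i; rewrite ler_norml => /andP[_ ?].
by have := upv_le_supv (k - j%:Z) i nb; have := upv_mono k x (leq_addl j i); lra.
Qed.

Definition home x : nat := (Num.truncn `|x : 'rV[R]_n|).+1.

Lemma natr_le_exp2 (j : nat) : j%:R <= 2 ^+ j :> R.
Proof. by rewrite -natrX ler_nat ltnW// ltn_expl. Qed.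

Lemma home_norm x : `|x| <= sc (home x)%:Z.
Proof.
rewrite sc_nat; apply: le_trans (natr_le_exp2 _); apply: ltW; exact: truncnS_gt.
Qed.

Lemma home_le x (r : R) : `|x| <= r -> (home x <= (Num.truncn r).+1)%N.
Proof. by move=> xr; rewrite ltnS le_truncn. Qed.

(* The total rise from infinitely coarse scales diverges. Subtracting the rise
   of the path at the origin, stopped at scale [1], leaves a quantity that depends
   on the starting scale only up to a bounded error. *)
Definition rise x : R := supv (home x)%:Z x - upv (home x)%:Z 0 (home x).

(** Above the home scale, the paths at [x] and at the origin rise by nearly equal amounts, which
    cancel. *)
Lemma rise_home K x : ~ bad x -> (home x <= K)%N ->
  `|supv K%:Z x - upv K%:Z 0 K - rise x| <= 2 * W + 4 * c0.
Proof.
move=> nb xK; set d := (K - home x)%N; rewrite /rise; set h := home x.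
have Kh : K%:Z - d%:Z = h%:Z by rewrite /d /h; lia.
have := supv_cat K%:Z d nb; rewrite Kh ler_norml => /andP[? ?].
have := upv_cat K%:Z 0 d h; rewrite Kh (_ : (d + h)%N = K); last by rewrite /d /h; lia.
rewrite ler_norml => /andP[? ?].
have := @upv_dist K%:Z x 0 d; rewrite Kh subr0 => /(_ (home_norm x)).
rewrite ler_norml => /andP[? ?].
by rewrite ler_norml; apply/andP; split; lra.
Qed.

Definition osc_const : R := 3 * W + 8 * c0.

Lemma rise_local x0 k : exists beta : R, forall x, ~ bad x -> `|x - x0| <= sc k ->
  `|rise x - beta - supv k x| <= osc_const.
Proof.
(* A scale above [k] and above the home scale of every point within [sc k] of [x0]. *)
pose K := maxn (Num.truncn (`|x0| + sc k)).+1 `|k|%N.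
have kK : k <= K%:Z by rewrite /K; lia.
pose d := `|K%:Z - k|%N.
have Kd : K%:Z - d%:Z = k by rewrite /d; lia.
exists (upv K%:Z x0 d - upv K%:Z 0 K) => x nb xx0.
have hx : (home x <= K)%N.
  rewrite leq_max home_le//; apply: le_trans (_ : `|x0 + (x - x0)| <= _).
    by rewrite addrC subrK.
  by apply: le_trans (ler_normD _ _) _; rewrite lerD2l.
have := rise_home nb hx; rewrite ler_norml => /andP[? ?].
have := supv_cat K%:Z d nb; rewrite Kd ler_norml => /andP[? ?].
have := @upv_dist K%:Z x x0 d; rewrite Kd => /(_ xx0); rewrite ler_norml => /andP[? ?].
by rewrite /osc_const ler_norml; apply/andP; split; lra.
Qed.

(** Nearly all of the rise at [x] occurs above some scale and is shared by the points within that
    scale; their remaining rise is nonnegative. In [weight_maximal_ge] this replaces Lebesgue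
    differentiation. *)
Lemma rise_lower x : ~ bad x -> exists k, forall y, ~ bad y -> `|y - x| <= sc k ->
  rise x - (2 * W + 2 * osc_const) <= rise y.
Proof.
move=> nb.
have [i hi] : exists i, supv 0 x - W < upv 0 x i.
  by apply: supv_gt => //; rewrite ltrBlDr ltrDl.
exists (0 - i%:Z) => y nby yx; have [beta betaP] := rise_local x (0 - i%:Z).
have := betaP y nby yx; have := betaP x nb.
rewrite subrr normr0 => /(_ (ltW (sc_gt0 _))).
have := supv_cat 0 i nb; rewrite !ler_norml => /andP[? ?] /andP[? ?] /andP[? ?].
have := supv_ge0 (0 - i%:Z) nby; lra.
Qed.

End Variation.

(** * John-Nirenberg estimate for the rise *)

Section JohnNirenberg.
Context {R : realType} {n : nat}.
Variables (delta : R) (a : int -> 'rV[R]_n -> R) (W : R).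
Local Notation H := (@hcontent R n delta).
Local Notation cube := (@cube R n).
Local Notation node := (nat * {ffun 'I_n -> nat})%type.
Local Notation upv := (upv a W).
Local Notation bad := (bad a W).

(** Nodes are a mere index type here: [q] and [lev] carry the geometry. The condition is symmetric
    under a change of sign of [a], so it also serves for the fall. *)
Definition stopping_covers : Prop := forall (k : int) (b : 'rV[R]_n),
  exists (D : set node) (q : node -> 'rV[R]_n) (lev : node -> nat),
    (\esum_(P in D) (sc (k - (lev P)%:Z) `^ delta)%:E
        <= (expR (- 2) * sc k `^ delta)%:E)%E /\
    forall x, cube b (sc k) x ->
      (exists P, [/\ D P, cube (q P) (sc (k - (lev P)%:Z)) x &
         forall j, (j <= lev P)%N -> `|a (k - j%:Z) x - a k x| <= W]) \/
      (forall j : nat, `|a (k - j%:Z) x - a k x| <= W).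

Hypothesis W_gt0 : 0 < W.
Hypothesis a_covering : stopping_covers.
Let W_ge0 : 0 <= W. Proof. exact: ltW. Qed.

(** The path does not rise before it reaches a stopping cube, and restarting it there costs one [W].
    A rise above [N.+1 * W] thus leaves more than [N * W] inside stopping cubes, whose total content
    carries the factor [expR (- 2)]. *)
Lemma john_nirenberg (N : nat) k b :
  (H [set x | cube b (sc k) x /\ exists i, (N%:R * W < upv k x i)%R]
    <= (expR (- (2 * N%:R)) * sc k `^ delta)%:E)%E.
Proof.
elim: N k b => [|N IH] k b.
  rewrite mulr0 oppr0 expR0 mul1r; apply: le_trans (hcontent_cube_le delta b (sc_gt0 k)).
  by apply: le_hcontent => x [].
have [D [q [lev [sumD cov]]]] := a_covering k b.
apply: le_trans (@hcontent_sub _ _ delta _ D (fun P =>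
  [set x | cube (q P) (sc (k - (lev P)%:Z)) x /\
     exists i, (N%:R * W < upv (k - (lev P)%:Z) x i)%R]) _ _) _.
  move=> x [bx [i ui]].
  have NW : 0 <= N%:R * W by rewrite mulr_ge0 ?ler0n.
  have ui0 : N%:R * W + W < upv k x i by move: ui; rewrite -natr1 mulrDl mul1r.
  case: (cov x bx) => [[P [DP qx small]]|small]; last first.
    have [|u0 _] := @up_small R W (path a k x) i.
      by move=> j _; rewrite path0; exact: small.
    by move: ui0; rewrite /upv u0; have := W_gt0; lra.
  exists P => //; split=> //; exists i.
  have [|u0 _] := @up_small R W (path a k x) (lev P).
    by move=> j jl; rewrite path0; exact: small.
  have := upv_cat a W_gt0 k x (lev P) i; rewrite {2}/upv u0 subr0 ler_norml => /andP[_ h].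
  have := @upv_mono R n a W k x i (lev P + i) (leq_addl _ _); lra.
apply: (@le_trans _ _ (\esum_(P in D) (expR (- (2 * N%:R)) * sc (k - (lev P)%:Z) `^ delta)%:E)%E).
  by apply: le_esum => P _; exact: IH.
apply: le_trans (esumZl_le _ (expR_ge0 _) _) _; first by move=> P; exact: powR_ge0.
apply: le_trans (lee_wpmul2l _ sumD) _; first by rewrite lee_fin expR_ge0.
rewrite -EFinM lee_fin mulrA -expRD.
rewrite le_eqVlt; apply/orP; left; apply/eqP; congr (expR _ * _); rewrite -natr1; ring.
Qed.

Lemma hcontent_bad : H bad = 0%E.
Proof.
apply: (hcontent_null_local ltr01) => b.
apply/eqP; rewrite eq_le hcontent_ge0 andbT; apply/lee_addgt0Pr => e e0; rewrite add0e.
pose N := (Num.truncn e^-1).+1.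
have eN : e^-1 < N%:R by exact: truncnS_gt.
apply: le_trans (le_trans _ (john_nirenberg N 0 b)) _.
  apply: le_hcontent => x [bx cx]; rewrite sc0; split=> //; exact: bx.
rewrite lee_fin sc0 powR1 mulr1 expRN -[leRHS]invrK lef_pV2 ?posrE ?expR_gt0 ?invr_gt0//.
apply: le_trans (ltW eN) (le_trans _ (expR_ge1Dx _)).
by have : 0 <= N%:R :> R by []; lra.
Qed.

End JohnNirenberg.

Section RiseAndFall.
Context {R : realType} {n : nat}.
Variables (a : int -> 'rV[R]_n -> R) (c0 W : R).
Hypothesis c0_ge0 : 0 <= c0.
Hypothesis W_gt0 : 0 < W.
Hypothesis a_smooth : smooth_in_scale a c0.
Local Notation aN := (fun k x => - a k x).

Lemma smooth_in_scaleN : smooth_in_scale aN c0.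
Proof. by move=> j x y i xy; rewrite -opprD normrN; exact: a_smooth. Qed.

Lemma stopping_coversN delta : stopping_covers delta a W -> stopping_covers delta aN W.
Proof.
move=> cov k b; have [D [q [lev [le h]]]] := cov k b; exists D, q, lev; split=> // x bx.
have [[P [DP qx small]]|small] := h x bx; [left; exists P; split=> //|right];
  by move=> j *; rewrite -opprD normrN; exact: small.
Qed.

Lemma rise_fall x : ~ bad a W x -> ~ bad aN W x -> exists k0, forall k, k <= k0 ->
  `|a k x - a 0 0 - (rise a W x - rise aN W x)| <= c0 + 4 * W.
Proof.
move=> nb nbN; have W0 := ltW W_gt0; set h := home x.
have [i1 h1] := upv_eventually W_gt0 h%:Z nb.
have [i2 h2] := upv_eventually W_gt0 h%:Z nbN.
pose m := maxn i1 i2; exists (h%:Z - m%:Z) => k km.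
pose i := `|h%:Z - k|%N.
have hi : h%:Z - i%:Z = k by rewrite /i; lia.
have mi : (m <= i)%N by rewrite /i; lia.
have /andP[? ?] := h1 i (leq_trans (leq_maxl _ _) mi).
have /andP[? ?] := h2 i (leq_trans (leq_maxr _ _) mi).
have updn y j : path a h%:Z y j - path a h%:Z y 0 =
    play W (path a h%:Z y) 0 j + upv a W h%:Z y j - upv aN W h%:Z y j.
  rewrite (play_up_down W0 (path a h%:Z y) 0 j) subr0 /upv.
  by congr (_ - up W _ _ _); rewrite oppr0.
have pl y j : `|play W (path a h%:Z y) 0 j| <= W by apply: play_bound; rewrite ?normr0.
(* The splitting is used at [x] down to scale [k] and at the origin down to scale 0, where the
   subtracted part of [rise] ends; the starting values differ by at most [c0]. *)
have := updn x i; rewrite path0 {1}/path hi => ux.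
have := updn 0 h; rewrite path0 {1}/path subrr => u0.
have := pl x i; have := pl 0 h; rewrite !ler_norml => /andP[? ?] /andP[? ?].
have := @a_smooth h%:Z x 0 0; rewrite subr0 => /(_ (home_norm x)).
rewrite addr0 expr0 divr1 ler_norml => /andP[? ?].
rewrite /rise -/h; apply/andP; split; lra.
Qed.

End RiseAndFall.

(* The exponential of the rise satisfies the [A_1] condition: on a cube the rise is
   a constant plus the nonnegative rise at finer scales, which is exponentially
   integrable. *)
Section Weights.
Context {R : realType} {n : nat}.
Variables (delta : R) (a : int -> 'rV[R]_n -> R) (c0 W s : R).
Hypothesis delta_gt0 : 0 < delta.
Hypothesis delta_le : delta <= n%:R.
Hypothesis c0_ge0 : 0 <= c0.
Hypothesis W_gt0 : 0 < W.
Hypothesis a_smooth : smooth_in_scale a c0.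
Hypothesis a_covering : stopping_covers delta a W.
Local Notation H := (@hcontent R n delta).
Local Notation cube := (@cube R n).
Local Notation bad := (bad a W).
Local Notation rise := (rise a W).
Local Notation osc := (osc_const c0 W).

(** On [bad] the supremum in [rise] is a mere default, so the weight is set to 0. The shift [s]
    carries an additive constant into the logarithm. *)
Definition weight (x : 'rV[R]_n) : R :=
  if `[< bad x >] then 0 else expR ((rise x + s) / W).

Lemma weight_good x : ~ bad x -> weight x = expR ((rise x + s) / W).
Proof. by rewrite /weight => nb; case: asboolP. Qed.

Lemma weight_ge0 x : 0 <= weight x.
Proof. by rewrite /weight; case: ifP => _; rewrite ?expR_ge0. Qed.

Definition weight_const : R := 4 * expR 2 * 2 `^ delta.

Lemma weight_const_gt0 : 0 < weight_const.
Proof. by rewrite !mulr_gt0 ?expR_gt0 ?powR_gt0. Qed.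

Lemma choquet_weight b (r : R) : 0 < r -> exists2 c : R, 0 < c &
  (choquet delta (cube b r) (fun x => `|(weight x)%:E|%E) <= (weight_const * c * r `^ delta)%:E)%E /\
  forall x, cube b r x -> ~ bad x -> c <= expR (2 * osc / W) * weight x.
Proof.
move=> r0; have [k [kr rk]] := sc_exists r0.
have [beta betaP] := rise_local c0_ge0 W_gt0 a_smooth b k.
have near x : cube b r x -> `|x - b| <= sc k.
  by move=> bx; apply: le_trans (cube_norm_le r0 bx) rk.
(* The constant part of the weight on the cube, enlarged by the error; the quotient is at most the
   exponential of the rise at finer scales. *)
pose c := expR ((beta + s + osc) / W); have c_gt0 : 0 < c by exact: expR_gt0.
exists c => //; split; last first.
  move=> x bx nb; rewrite weight_good// -expRD ler_expR -mulrDl ler_pM2r ?invr_gt0//.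
  have := betaP x nb (near x bx); have := supv_ge0 W_gt0 k nb.
  by rewrite ler_norml => ? /andP[? ?]; lra.
have scr : sc k `^ delta <= 2 `^ delta * r `^ delta.
  rewrite -powRM ?(ltW r0)//; apply: ge0_ler_powR; rewrite ?nnegrE ?(ltW (sc_gt0 _)) ?mulr_ge0 ?(ltW r0) ?(ltW delta_gt0)//.
  by have := scS (R := R) (k - 1); rewrite subrK; lra.
have -> : weight_const * c * r `^ delta = (4 * expR 2 * (2 `^ delta * r `^ delta)) * c.
  by rewrite /weight_const; ring.
apply: choquet_le_tail => //; first by rewrite !mulr_ge0 ?expR_ge0 ?powR_ge0.
move=> t t0; pose tau := t / c; have tau0 : 0 < tau by rewrite divr_gt0.
have c_ne : c != 0 by rewrite gt_eqF.
(* For [tau >= 1], rounding down costs a factor [expR 2], and the tail factor is at most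
   [expR 2 / tau ^+ 2]. *)
pose N := Num.truncn (ln tau).
have exc x : cube b r x -> t < weight x -> ~ bad x /\ W * ln tau < supv a W k x.
  move=> bx; rewrite /weight; case: asboolP => nb tx; first by lra.
  split=> //; have := betaP x nb (near x bx); rewrite ler_norml => /andP[_ ?].
  have : ln tau < supv a W k x / W.
    rewrite -ltr_expR lnK ?posrE// /tau ltr_pdivrMr// mulrC.
    apply: lt_le_trans tx _; rewrite -expRD ler_expR -mulrDl ler_pM2r ?invr_gt0//; lra.
  by rewrite ltr_pdivlMr// mulrC.
have tailE : c ^+ 2 / (c + t) ^+ 2 = ((1 + tau) ^+ 2)^-1.
  have ct : c + t != 0 by rewrite gt_eqF// addr_gt0.
  have tc : t + c != 0 by rewrite addrC.
  by rewrite /tau; field; rewrite ?c_ne ?ct ?tc.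
have pr : 0 < 2 `^ delta * r `^ delta by rewrite mulr_gt0 ?powR_gt0.
have e2 : 1 <= expR 2 :> R by rewrite -[leLHS]expR0 ler_expR.
have [tau1|tau1] := ltP tau 1.
  apply: (@le_trans _ _ (sc k `^ delta)%:E).
    apply: le_trans (hcontent_cube_le delta b (sc_gt0 k)).
    apply: le_hcontent => x [bx _] i; have /andP[? ?] := bx i.
    by apply/andP; split; lra.
  rewrite lee_fin; apply: le_trans scr _; rewrite tailE.
  rewrite [_ * (2 `^ _ * _)]mulrC -mulrA -[leLHS]mulr1 ler_pM2l//.
  rewrite -ler_pdivrMr ?invr_gt0 ?exprn_gt0//; last lra.
  rewrite invrK mul1r; apply: (@le_trans _ _ 4); last lra.
  have : (1 + tau) ^+ 2 <= 2 ^+ 2 by apply: lerXn2r; rewrite ?nnegrE; lra.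
  by rewrite -natrX.
have lt0 : 0 <= ln tau by rewrite ln_ge0.
have /andP[N1 N2] := truncn_itv lt0.
apply: (@le_trans _ _ (expR (- (2 * N%:R)) * sc k `^ delta)%:E).
  apply: le_trans (john_nirenberg W_gt0 a_covering N k b).
  apply: le_hcontent => x [bx]; rewrite lte_fin ger0_norm ?weight_ge0// => tx.
  have [nb us] := exc x bx tx; split.
    by move=> i; have /andP[? ?] := bx i; apply/andP; split; lra.
  apply: supv_gt => //; apply: le_lt_trans us.
  by rewrite mulrC ler_pM2l.
rewrite lee_fin tailE [leRHS]mulrAC; apply: ler_pM; rewrite ?expR_ge0 ?powR_ge0//.
have -> : (4 * expR 2 / (1 + tau) ^+ 2) = expR 2 * (4 / (1 + tau) ^+ 2) by ring.
apply: (@le_trans _ _ (expR 2 * expR (- (2 * ln tau)))).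
  rewrite -expRD ler_expR; move: N2; rewrite -natr1 -/N; lra.
rewrite ler_pM2l ?expR_gt0// expRN [2 * _]mulr_natl mulr2n expRD lnK ?posrE//.
rewrite -expr2 ler_pdivlMr ?exprn_gt0//; last lra.
rewrite mulrC ler_pdivrMr ?exprn_gt0//.
have : (1 + tau) ^+ 2 <= (2 * tau) ^+ 2 by apply: lerXn2r; rewrite ?nnegrE; lra.
by rewrite exprMn -natrX.
Qed.

Local Notation g := (EFin \o weight).

Lemma weight_maximal_le x : ~ bad x ->
  (hc_maximal delta g x <=
     (weight_const / kappa delta * expR (2 * osc / W) * weight x)%:E)%E.
Proof.
move=> nb; apply: ge_ereal_sup => _ [_ [[b [r [r0 ->]]] bx] <-].
have [c c_gt0 [le cw]] := choquet_weight b r0.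
apply: le_trans (hc_mean_le delta_gt0 delta_le r0 _ le) _.
  by rewrite mulr_ge0// ltW// weight_const_gt0.
rewrite lee_fin mulrAC -[leRHS]mulrA ler_pM2l; last first.
  by rewrite divr_gt0 ?weight_const_gt0// kappa_gt0.
exact: cw.
Qed.

Lemma weight_maximal_ge x : ~ bad x ->
  ((expR (- ((2 * W + 2 * osc) / W)) / 2 * weight x)%:E <= hc_maximal delta g x)%E.
Proof.
move=> nb; have [k kP] := rise_lower c0_ge0 W_gt0 a_smooth nb.
pose b := x - const_mx (sc k); have k0 : 0 < sc k :> R := sc_gt0 k.
have bx : cube b (sc k) x by move=> i; rewrite !mxE; apply/andP; split; lra.
apply: (@le_trans _ _ (hc_mean delta (cube b (sc k)) (fun y => `|g y|%E))); last first.
  by apply: ereal_sup_ubound; exists (cube b (sc k)) => //; split=> //; exists b, (sc k).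
have [h hE [h0 _]] := hcontent_cube delta_gt0 delta_le b k0.
rewrite /hc_mean hE inver gt_eqF// -lee_pdivrMl ?invr_gt0// invrK.
set m := _ * weight x.
have m0 : 0 <= m by rewrite !mulr_ge0 ?expR_ge0 ?weight_ge0.
apply: le_trans (choquet_chebyshev delta (cube b (sc k)) (fun y => `|g y|%E) m0).
rewrite muleC lee_wpmul2l ?lee_fin// -hE.
rewrite -(hcontentUnull [set y | cube b (sc k) y /\ (m%:E < `|g y|)%E] (hcontent_bad W_gt0 a_covering)).
apply: le_hcontent => y by_; have [nby|nby] := pselect (bad y); [by right|left].
split=> //; rewrite lte_fin ger0_norm ?weight_ge0//.
have /kP-/(_ nby) : `|y - x| <= sc k.
  apply: norm_le_coord; first exact: ltW.
  by move=> i; have /andP[] := by_ i; rewrite !mxE ler_norml => ? ?; apply/andP; split; lra.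
rewrite /m !weight_good// => le.
(* The factor 1 / 2 in [m] yields the strict inequality required by the level set. *)
apply: (@lt_le_trans _ _ (expR (- ((2 * W + 2 * osc) / W)) * expR ((rise x + s) / W))).
  by rewrite ltr_pM2r ?expR_gt0// gtr_pMr ?expR_gt0// invf_lt1// ltr1n.
rewrite -expRD -mulNr -mulrDl ler_expR ler_pM2r ?invr_gt0//; lra.
Qed.

Lemma weight_L1loc : hc_L1loc delta g.
Proof.
move=> K /compact_sub_cube[b [r [r0 Kb]]]; have [c _ [le _]] := choquet_weight b r0.
apply: le_lt_trans (le_trans (le_choquet (hcontent0 delta) Kb _) le) (ltry _).
by move=> x _ _.
Qed.

End Weights.

(** * Means of a function of bounded mean oscillation *)

Section BoundedOscillation.
Context {R : realType} {n : nat}.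
Variables (delta A : R) (f : 'rV[R]_n -> \bar R) (m : int -> 'rV[R]_n -> R).
Hypothesis delta_gt0 : 0 < delta.
Hypothesis delta_le : delta <= n%:R.
Hypothesis A_gt0 : 0 < A.
Local Notation H := (@hcontent R n delta).
Local Notation cube := (@cube R n).
Local Notation node := (nat * {ffun 'I_n -> nat})%type.
Local Notation kap := (kappa delta).

Definition box (k : int) x := cube (x - const_mx (sc k)) (2 * sc k).

Hypothesis m_mean : forall k x,
  (choquet delta (box k x) (fun y => `|f y - (m k x)%:E|) <= (A * (2 * sc k) `^ delta)%:E)%E.

Let kap_gt0 : 0 < kap. Proof. exact: kappa_gt0. Qed.
Let p4_gt0 : 0 < 4 `^ delta :> R. Proof. by rewrite powR_gt0. Qed.
Let p2_gt0 : 0 < 2 `^ delta :> R. Proof. by rewrite powR_gt0. Qed.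

(** Twice the threshold beyond which each of the two deviations in [mean_compare] fills at most a
    third of the least content of the common cube, so that some point is close to both means. *)
Definition jump : R := 6 * 4 `^ delta * A / kap.

Lemma jump_gt0 : 0 < jump. Proof. by rewrite divr_gt0// !mulr_gt0. Qed.

Lemma sc2_gt0 k : 0 < 2 * sc k :> R. Proof. by rewrite mulr_gt0// sc_gt0. Qed.

Lemma powR_le (x y : R) : 0 <= x -> x <= y -> x `^ delta <= y `^ delta.
Proof.
move=> x0 xy; apply: ge0_ler_powR; rewrite ?nnegrE ?(ltW delta_gt0)//.
exact: le_trans xy.
Qed.

Lemma box_exceed k x (t : R) : 0 < t ->
  (H [set y | box k x y /\ (t%:E < `|f y - (m k x)%:E|)%E]
    <= (A * (2 * sc k) `^ delta / t)%:E)%E.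
Proof.
move=> t0; have := choquet_chebyshev delta (box k x) (fun y => `|f y - (m k x)%:E|%E) (ltW t0).
move=> /le_trans /(_ (m_mean k x)); rewrite -lee_pdivlMl// => /le_trans; apply.
by rewrite -EFinM lee_fin mulrC.
Qed.

Lemma dist_gt_or (y : \bar R) (c d t : R) : 2 * t < `|c - d| ->
  (t%:E < `|y - c%:E| \/ t%:E < `|y - d%:E|)%E.
Proof.
case: y => [y| |] h; rewrite ?ltry; try by left.
rewrite !lte_fin; have [|le1] := ltP t `|y - c|; first by left.
have [|le2] := ltP t `|y - d|; first by right.
exfalso; move: h; apply/negP; rewrite -leNgt.
have -> : c - d = (y - d) - (y - c) by ring.
by apply: le_trans (ler_normB _ _) _; lra.
Qed.

Lemma mean_compare k k' x x' b (r : R) : 0 < r ->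
  cube b r `<=` box k x -> cube b r `<=` box k' x' ->
  2 * sc k <= 4 * r -> 2 * sc k' <= 4 * r -> `|m k x - m k' x'| <= jump.
Proof.
move=> r0 sub sub' kr kr'; rewrite leNgt; apply/negP => far.
pose t := 3 * 4 `^ delta * A / kap.
have t0 : 0 < t by rewrite divr_gt0// !mulr_gt0.
have far2 : 2 * t < `|m k x - m k' x'|.
  by apply: le_lt_trans far; rewrite /t /jump; lra.
have := hcontent_cube_ge delta_gt0 delta_le b r0; apply/negP; rewrite -ltNge.
apply: le_lt_trans (_ : (_ <= H ([set y | box k x y /\ (t%:E < `|f y - (m k x)%:E|)%E] `|`
   [set y | box k' x' y /\ (t%:E < `|f y - (m k' x')%:E|)%E]))%E) _.
  apply: le_hcontent => y by_; have [h|h] := dist_gt_or (f y) far2.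
    by left; split=> //; exact: sub.
  by right; split=> //; exact: sub'.
apply: le_lt_trans (hcontentU _ _ _) _.
apply: le_lt_trans (leeD (box_exceed k x t0) (box_exceed k' x' t0)) _.
have pr : 0 < r `^ delta by rewrite powR_gt0.
have bd j : 2 * sc j <= 4 * r -> A * (2 * sc j) `^ delta / t <= kap / 3 * r `^ delta.
  move=> jr; have -> : kap / 3 * r `^ delta = A * (4 `^ delta * r `^ delta) / t.
    by rewrite /t; field; rewrite !gt_eqF.
  rewrite ler_pM2r ?invr_gt0// ler_pM2l// -powRM ?(ltW r0)//; apply: powR_le => //.
  exact/ltW/sc2_gt0.
rewrite -EFinD lte_fin; apply: le_lt_trans (lerD (bd _ kr) (bd _ kr')) _.
have : 0 < kap * r `^ delta by rewrite mulr_gt0.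
lra.
Qed.

Lemma m_near k x y : `|x - y| <= sc k -> `|m k x - m k y| <= jump.
Proof.
move=> xy; have k0 : 0 < sc k :> R := sc_gt0 k.
have xyi i : `|x ord0 i - y ord0 i| <= sc k.
  by have := le_coord_norm (x - y) i; rewrite !mxE => /le_trans; apply.
pose b : 'rV[R]_n := \row_i (Num.max (x ord0 i) (y ord0 i) - sc k).
apply: (@mean_compare k k x y b (sc k)) => //; last 2 first.
- lra.
- lra.
- move=> z bz i; have := bz i; have := xyi i; rewrite !mxE ler_norml.
  by case: (leP (x ord0 i) (y ord0 i)) => ? /andP[? ?] /andP[? ?]; apply/andP; split; lra.
- move=> z bz i; have := bz i; have := xyi i; rewrite !mxE ler_norml.
  by case: (leP (x ord0 i) (y ord0 i)) => ? /andP[? ?] /andP[? ?]; apply/andP; split; lra.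
Qed.

Lemma m_step k x : `|m k x - m (k - 1) x| <= jump.
Proof.
have s1 : sc k = 2 * sc (k - 1) :> R by rewrite -scS subrK.
have k0 : 0 < sc (k - 1) :> R := sc_gt0 _.
apply: (@mean_compare k (k - 1) x x (x - const_mx (sc (k - 1))) (2 * sc (k - 1))); rewrite ?s1; try lra.
- move=> z bz i; have := bz i; rewrite !mxE s1 => /andP[? ?]; apply/andP; split; lra.
- by [].
Qed.

(* Inf-convolution with a cone of slope [2 jump / sc k] makes the mean at scale
   [sc k] Lipschitz in [x], at the cost of an error [jump]. *)
Definition smooth_mean k (x : 'rV[R]_n) : R :=
  inf [set m k y + 2 * jump * `|x - y| / sc k | y in [set y | `|x - y| <= sc k]].

Lemma smooth_mean_lb k x y : `|x - y| <= sc k ->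
  m k x - jump <= m k y + 2 * jump * `|x - y| / sc k.
Proof.
move=> xy; have := m_near xy; rewrite ler_norml => /andP[? ?].
have : 0 <= 2 * jump * `|x - y| / sc k.
  apply: divr_ge0; last exact/ltW/sc_gt0.
  by apply: mulr_ge0 => //; apply: mulr_ge0 => //; exact/ltW/jump_gt0.
lra.
Qed.

Lemma smooth_mean_le k x y : `|x - y| <= sc k ->
  smooth_mean k x <= m k y + 2 * jump * `|x - y| / sc k.
Proof.
move=> xy; apply: ge_inf; last by exists y.
by exists (m k x - jump) => _ [z /= xz <-]; exact: smooth_mean_lb.
Qed.

Lemma smooth_mean_near k x : `|smooth_mean k x - m k x| <= jump.
Proof.
have k0 := sc_gt0 (R := R) k; have xx : `|x - x| <= sc k by rewrite subrr normr0 ltW.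
have := smooth_mean_le xx; rewrite subrr normr0 mulr0 mul0r addr0 => le.
rewrite ler_norml; apply/andP; split; last by have := jump_gt0; lra.
suff : m k x - jump <= smooth_mean k x by lra.
apply: lb_le_inf; first by exists (m k x + 2 * jump * `|x - x| / sc k), x.
by move=> _ [z /= xz <-]; exact: smooth_mean_lb.
Qed.

Lemma smooth_mean_lip k x y : `|x - y| <= sc k / 4 ->
  smooth_mean k y <= smooth_mean k x + 2 * jump * `|x - y| / sc k.
Proof.
move=> xy; have k0 := sc_gt0 (R := R) k; have j0 := jump_gt0.
apply/ler_addgt0Pr => e e0; pose eta := Num.min e (jump / 2).
have eta0 : 0 < eta by rewrite lt_min e0 divr_gt0.
have etae : eta <= e by rewrite ge_min lexx.
have etaj : eta <= jump / 2 by rewrite ge_min lexx orbT.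
have xx : `|x - x| <= sc k by rewrite subrr normr0 ltW.
have [_ [z /= xz <-] zlt] : exists2 v, [set m k y + 2 * jump * `|x - y| / sc k |
    y in [set y | `|x - y| <= sc k]] v & v < smooth_mean k x + eta.
  apply: inf_adherent => //; split; first by exists (m k x + 2 * jump * `|x - x| / sc k), x.
  by exists (m k x - jump) => _ [z /= xz <-]; exact: smooth_mean_lb.
(* Near-minimality bounds the cone term at [z] by [3 / 2 * jump]. Hence [z] lies well inside the
   admissible radius and stays admissible for [y]. *)
have small : `|x - z| <= 3 / 4 * sc k.
  have := m_near xz; rewrite ler_norml => /andP[_ ?].
  have := smooth_mean_le xx; rewrite subrr normr0 mulr0 mul0r addr0 => ?.
  have : 2 * jump * `|x - z| / sc k <= 2 * jump * (3 / 4) by lra.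
  rewrite ler_pdivrMr// -[leRHS]mulrA ler_pM2l//; lra.
have yz : `|y - z| <= sc k.
  have -> : y - z = (x - z) - (x - y) by rewrite opprB [RHS]addrC addrA subrK.
  by apply: le_trans (ler_normB _ _) _; lra.
apply: le_trans (smooth_mean_le yz) _.
have tri : `|y - z| <= `|x - z| + `|x - y|.
  have -> : y - z = (x - z) - (x - y) by rewrite opprB [RHS]addrC addrA subrK.
  exact: ler_normB.
have : 2 * jump * `|y - z| / sc k <= 2 * jump * `|x - z| / sc k + 2 * jump * `|x - y| / sc k.
  by rewrite -mulrDl ler_pM2r ?invr_gt0// -mulrDr ler_pM2l//; lra.
lra.
Qed.

Lemma smooth_mean_smooth : smooth_in_scale smooth_mean (6 * jump).
Proof.
move=> j x y i xy; have j0 := jump_gt0; set k := j + i%:Z.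
have kj : sc k = sc j * 2 ^+ i :> R by rewrite scD.
have sj := sc_gt0 (R := R) j; have sk := sc_gt0 (R := R) k.
have xyk : `|x - y| <= sc k.
  by apply: le_trans xy _; rewrite kj ler_pMr// exprn_ege1// ler1n.
(* For [i < 2] the error [jump] of the regularization is already within the bound; from [i = 2] on
   the points are close enough for [smooth_mean_lip]. *)
have [i2|i2] := ltnP i 2.
  have := smooth_mean_near k x; have := smooth_mean_near k y; have := m_near xyk.
  rewrite !ler_norml => /andP[? ?] /andP[? ?] /andP[? ?].
  have : 3 * jump <= 6 * jump / 2 ^+ i.
    by move: (i) i2 => [|[|]]// _; rewrite ?expr0 ?expr1; lra.
  by move=> ?; apply/andP; split; lra.
have xy4 : `|x - y| <= sc k / 4.
  apply: le_trans xy _; rewrite kj ler_pdivlMr// ler_pM2l//.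
  by apply: (@le_trans _ _ (2 ^+ 2)); [rewrite -natrX|rewrite ler_weXn2l ?ler1n].
have bd : 2 * jump * `|x - y| / sc k <= 6 * jump / 2 ^+ i.
  apply: (@le_trans _ _ (2 * jump * sc j / sc k)).
    by rewrite ler_pM2r ?invr_gt0// ler_pM2l// mulr_gt0.
  rewrite kj; have -> : 2 * jump * sc j / (sc j * 2 ^+ i) = 2 * jump / 2 ^+ i.
    by field; rewrite expf_neq0// gt_eqF.
  by rewrite ler_pM2r ?invr_gt0 ?exprn_gt0//; lra.
have h1 := smooth_mean_lip xy4; have h2 : smooth_mean k x <= smooth_mean k y + 2 * jump * `|x - y| / sc k.
  by rewrite (distrC x y); apply: smooth_mean_lip; rewrite distrC.
by rewrite ler_norml; apply/andP; split; lra.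
Qed.

(** Chosen so that the packing bound for the stopping nodes is exactly [expR (- 2)] times the weight
    of the cube. *)
Definition stop_level : R :=
  @packing_const R n delta * A * 2 `^ delta * (2 / kap) * expR 2.

(** Three [jump] pass from regularized to raw means and to the corner [b]; three more pay for the
    step from the last light generation to that of the stopping cube. *)
Definition window : R := 2 * stop_level + 6 * jump.

Lemma stop_level_gt0 : 0 < stop_level.
Proof.
by rewrite !mulr_gt0 ?packing_const_gt0 ?expR_gt0 ?invr_gt0 ?kap_gt0.
Qed.

Lemma packing_const_ge1 : 1 <= @packing_const R n delta.
Proof.
rewrite /packing_const -[leLHS]mul1r ler_pM ?ler1n ?expn_gt0//.
by rewrite lerDr mulr_ge0// powR_ge0.
Qed.

Lemma stop_level_ge : A * 2 `^ delta * (2 / kap) <= stop_level.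
Proof.
have X0 : 0 < A * 2 `^ delta * (2 / kap) by rewrite !mulr_gt0 ?invr_gt0 ?kap_gt0.
have -> : stop_level = A * 2 `^ delta * (2 / kap) * (@packing_const R n delta * expR 2).
  by rewrite /stop_level; ring.
rewrite -[leLHS]mulr1 ler_pM2l// -[leLHS]mulr1 ler_pM ?packing_const_ge1//.
by rewrite -[leLHS]expR0 ler_expR.
Qed.

Lemma window_gt0 : 0 < window.
Proof. by have := stop_level_gt0; have := jump_gt0; rewrite /window; lra. Qed.

Section Stopping.
Variables (k : int) (b : 'rV[R]_n).
Let l : R := sc k.
Let l_gt0 : 0 < l. Proof. exact: sc_gt0. Qed.
Local Notation ns := (nset (cube b l) (code b l)).

Definition far_set : set 'rV[R]_n :=
  [set y | cube b l y /\ (stop_level%:E < `|f y - (m k b)%:E|)%E].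

Lemma hcontent_far_set :
  (H far_set <= (A * (2 * l) `^ delta / stop_level)%:E)%E.
Proof.
apply: le_trans (box_exceed k b stop_level_gt0); apply: le_hcontent => y [by_ fy].
split=> // i; have := l_gt0; have /andP[? ?] := by_ i; rewrite !mxE -/l => ?.
by apply/andP; split; lra.
Qed.

Definition far_heavy : set node :=
  [set P | ((kap / 2 * rho delta l P.1)%:E <= H (far_set `&` ns P))%E].

Lemma side_sc j : side l j = sc (k - j%:Z).
Proof. by rewrite /side scB. Qed.

(** When the two means are far apart, each point of the node deviates from one of them. Deviation
    from the mean of the node fills at most half of its least content, so [far_set] must fill the
    rest. *)
Lemma far_heavy_of_jump j x : cube b l x ->
  2 * stop_level + 3 * jump < `|smooth_mean (k - j%:Z) x - smooth_mean k x| ->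
  far_heavy (j, code b l j x).
Proof.
move=> bx far; set P := (j, _); set k' := k - j%:Z.
have Px : ns P x by [].
have s0 := sc_gt0 (R := R) k'.
have PE : ns P = cube (corner b l P) (sc k').
  by rewrite (nset_cube l_gt0) ?side_sc//; exists x.
have Pbox : ns P `<=` box k' x.
  move=> y; rewrite PE => Py i; move: Px; rewrite PE => Px.
  have /andP[? ?] := Py i; have /andP[? ?] := Px i.
  by rewrite !mxE; apply/andP; split; lra.
have far2 : 2 * stop_level < `|m k b - m k' x|.
  rewrite ltNge; apply/negP => le; move: far; apply/negP; rewrite -leNgt.
  have -> : smooth_mean k' x - smooth_mean k x = (smooth_mean k' x - m k' x)
    - (smooth_mean k x - m k x) - (m k x - m k b) - (m k b - m k' x) by ring.
  apply: le_trans (ler_normB _ _) _.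
  apply: le_trans (lerD (le_trans (ler_normB _ _) (lerD (ler_normB _ _) (lexx _))) le) _.
  have := smooth_mean_near k' x; have := smooth_mean_near k x.
  have := m_near (cube_norm_le l_gt0 bx); lra.
have rE : rho delta l j = sc k' `^ delta by rewrite /rho side_sc.
have small : (H [set y | box k' x y /\ (stop_level%:E < `|f y - (m k' x)%:E|)%E]
    <= (kap / 2 * rho delta l j)%:E)%E.
  apply: le_trans (box_exceed k' x stop_level_gt0) _.
  rewrite lee_fin rE powRM ?(ltW s0)// ler_pdivrMr ?stop_level_gt0//.
  have pr : 0 < sc k' `^ delta by rewrite powR_gt0.
  rewrite mulrA [leRHS]mulrAC ler_pM2r//.
  rewrite -ler_pdivrMl ?divr_gt0//; apply: le_trans stop_level_ge.
  by rewrite le_eqVlt; apply/orP; left; apply/eqP; field; rewrite gt_eqF.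
have := hcontent_cube_ge delta_gt0 delta_le (corner b l P) s0.
rewrite -PE => le1.
rewrite /far_heavy /=.
have : (H (ns P) <= H ((far_set `&` ns P) `|`
    [set y | box k' x y /\ (stop_level%:E < `|f y - (m k' x)%:E|)%E]))%E.
  apply: le_hcontent => y Py; have [h|h] := dist_gt_or (f y) far2.
    by left; split=> //; split=> //; exact: Py.1.
  by right; split=> //; exact: Pbox.
move=> /(le_trans le1)/le_trans/(_ (hcontentU _ _ _)) le2.
have := le_trans le2 (leeD (lexx _) small).
rewrite -leeBlDr// -EFinB; apply: le_trans.
by rewrite lee_fin -rE; lra.
Qed.

Lemma stopping_cover_at : exists (D : set node) (q : node -> 'rV[R]_n) (lev : node -> nat),
    (\esum_(P in D) (sc (k - (lev P)%:Z) `^ delta)%:E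
        <= (expR (- 2) * sc k `^ delta)%:E)%E /\
    forall x, cube b (sc k) x ->
      (exists P, [/\ D P, cube (q P) (sc (k - (lev P)%:Z)) x &
         forall j, (j <= lev P)%N -> `|smooth_mean (k - j%:Z) x - smooth_mean k x| <= window]) \/
      (forall j : nat, `|smooth_mean (k - j%:Z) x - smooth_mean k x| <= window).
Proof.
have j0 := jump_gt0; have t0 := stop_level_gt0.
have pl : 0 < l `^ delta by rewrite powR_gt0.
have pk : 0 < @packing_const R n delta := packing_const_gt0 delta.
have k20 : 0 < kap / 2 by rewrite divr_gt0.
have [|Cov [C1 C2 C3]] := @dyadic_covering R n delta b l delta_gt0 l_gt0
  (fun P => H (far_set `&` ns P)) (kap / 2) (expR (- 2) * l `^ delta) k20.
  move=> s us ds ps.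
  apply: le_trans (@packed_hcontent R n delta b l delta_gt0 l_gt0 s far_set us ds ps _) _.
    by move=> y [].
  apply: le_trans (lee_wpmul2l _ hcontent_far_set) _; first by rewrite lee_fin ltW.
  rewrite -EFinM lee_fin powRM ?(ltW l_gt0)// expRN le_eqVlt; apply/orP; left; apply/eqP.
  by rewrite /stop_level; field; rewrite !gt_eqF ?expR_gt0.
rewrite -/far_heavy in C1 C2.
have step j x : `|smooth_mean (k - j%:Z) x - smooth_mean (k - j.+1%:Z) x| <= 3 * jump.
  have -> : k - j.+1%:Z = k - j%:Z - 1 by rewrite -addn1 PoszD opprD addrA.
  have := smooth_mean_near (k - j%:Z) x; have := smooth_mean_near (k - j%:Z - 1) x.
  have := m_step (k - j%:Z) x; rewrite !ler_norml => /andP[? ?] /andP[? ?] /andP[? ?].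
  by apply/andP; split; lra.
have light j x : cube b l x -> ~ far_heavy (j, code b l j x) ->
    `|smooth_mean (k - j%:Z) x - smooth_mean k x| <= 2 * stop_level + 3 * jump.
  by move=> bx nh; rewrite leNgt; apply/negP => /(far_heavy_of_jump bx).
exists Cov, (corner b l), fst; split.
  by move: C3; rewrite /rho; under eq_esum do rewrite side_sc.
move=> x bx.
have [[Q [CQ Qx]]|none] := pselect (exists Q, Cov Q /\ ns Q x); [left|right].
  exists Q; split=> //; first by rewrite -side_sc; exact: nset_sub_cube.
  (* A heavy node strictly coarser than [Q] would contain a maximal heavy node lying in [Q], against
     maximality. *)
  have strict j : (j < Q.1)%N -> `|smooth_mean (k - j%:Z) x - smooth_mean k x| <=
      2 * stop_level + 3 * jump.
    move=> jQ; apply: light => // hj; have [P [hP [y Py] mP] [QP PQ]] := C1 Q CQ.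
    have Qy := PQ y Py.
    have codexy : code b l j x = code b l j y.
      apply: (@code_le _ _ (cube b l) (code b l) (@codeS _ _ _ _ l_gt0) _ Q.1) => //.
      - exact: Qy.1.
      - exact: ltnW.
      - by rewrite Qx.2 Qy.2.
    have : descend (cube b l) (code b l) P (j, code b l j x).
      apply: (descend_meet (@codeS _ _ _ _ l_gt0) Py).
        by rewrite codexy; split=> //; exact: Qy.1.
      by apply: leq_trans QP; exact: ltnW.
    move=> /(mP _ hj) /= jP; move: jQ; rewrite jP ltnNge; by rewrite QP.
  move=> j; rewrite leq_eqVlt => /predU1P[->|/strict le]; last by rewrite /window; lra.
  case: Q.1 strict => [|i] strict.
    by rewrite subr0 subrr normr0 ltW// window_gt0.
  have := strict i (ltnSn _); have := step i x; rewrite /window !ler_norml => /andP[? ?] /andP[? ?].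
  by apply/andP; split; lra.
move=> j; rewrite /window; apply: le_trans (light j x bx _) _; last lra.
move=> hj; apply: none; have [Q CQ [_ PQ]] := C2 _ x hj (conj bx erefl).
by exists Q; split=> //; exact: PQ.
Qed.

End Stopping.

Lemma smooth_mean_covers : stopping_covers delta smooth_mean window.
Proof. by move=> k b; exact: stopping_cover_at. Qed.

End BoundedOscillation.

(** * Decomposition *)

Section Decomposition.
Context {R : realType} {n : nat}.
Variables (delta A : R) (f : 'rV[R]_n -> \bar R) (m : int -> 'rV[R]_n -> R).
Hypothesis delta_gt0 : 0 < delta.
Hypothesis delta_le : delta <= n%:R.
Hypothesis A_gt0 : 0 < A.
Local Notation H := (@hcontent R n delta).
Local Notation cube := (@cube R n).
Local Notation kap := (kappa delta).
Hypothesis m_mean : forall k x,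
  (choquet delta (box k x) (fun y => `|f y - (m k x)%:E|) <= (A * (2 * sc k) `^ delta)%:E)%E.

Local Notation jump := (jump delta A).
Local Notation W := (@window R n delta A).
Local Notation a := (smooth_mean delta A m).
Local Notation aN := (fun k x => - a k x).

Let j_gt0 : 0 < jump. Proof. exact: jump_gt0. Qed.
Let W_gt0 : 0 < W. Proof. exact: window_gt0. Qed.
Let a_smooth : smooth_in_scale a (6 * jump).
Proof. exact: (smooth_mean_smooth delta_gt0 delta_le A_gt0 m_mean). Qed.
Let a_covers : stopping_covers delta a W.
Proof. exact: (smooth_mean_covers delta_gt0 delta_le A_gt0 m_mean). Qed.
Let aN_smooth : smooth_in_scale aN (6 * jump). Proof. exact: smooth_in_scaleN. Qed.
Let aN_covers : stopping_covers delta aN W. Proof. exact: stopping_coversN. Qed.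
Let c0_ge0 : 0 <= 6 * jump. Proof. by rewrite mulr_ge0// ltW. Qed.

Definition limit x : R := a 0 0 + (rise a W x - rise aN W x).

Definition mean_error : R := 7 * jump + 4 * W.
Definition limit_error : R := mean_error + 2 * A + 2 * 4 `^ delta * A.

Lemma mean_to_limit x : ~ bad a W x -> ~ bad aN W x ->
  exists k0, forall k, k <= k0 -> `|m k x - limit x| <= mean_error.
Proof.
move=> nb nbN; have [k0 h0] := rise_fall c0_ge0 W_gt0 a_smooth nb nbN.
exists k0 => k kk0; have := h0 k kk0; rewrite opprD addrA -/(limit x).
have := smooth_mean_near delta_gt0 delta_le A_gt0 m_mean k x.
rewrite /mean_error /limit !ler_norml => /andP[? ?] /andP[? ?].
by apply/andP; split; lra.
Qed.

Definition exceptional : set 'rV[R]_n := [set x | ~ bad a W x /\ ~ bad aN W x /\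
  (limit_error%:E < `|f x - (limit x)%:E|)%E].

(** Countably many pieces have a uniform scale of convergence and a value of [limit] fixed up to
    [A]. In a small cube, [f] on such a piece deviates from one single mean, which bounds the
    density of the piece by 1 / 2. *)
Lemma hcontent_exceptional : H exceptional = 0%E.
Proof.
pose E (kq : int * int) := [set x | exceptional x /\
  (forall k, k <= kq.1 -> `|m k x - limit x| <= mean_error) /\
  `|limit x - kq.2%:~R * A| <= A].
apply: (@hcontent_null_bigcup _ _ delta _ E); last first.
  move=> x [nb [nbN fx]]; have [k0 h0] := mean_to_limit nb nbN.
  exists (k0, Num.floor (limit x / A)) => //; split=> //; split=> //=.
  have /andP[h1 h2] := floor_itv (limit x / A).
  set q := (Num.floor _)%:~R in h1 *; rewrite intrD -/q in h2.
  have ? : q * A <= limit x by rewrite -ler_pdivlMr.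
  have : limit x < (q + 1) * A by rewrite -ltr_pdivrMr.
  by rewrite mulrDl mul1r => ?; rewrite ler_norml; apply/andP; split; lra.
move=> [k0 q]; apply: (@hcontent_null_density _ _ delta delta_gt0 (1 / 2) (sc k0)).
- lra.
- exact: sc_gt0.
move=> b r r0 rk0.
have [[x [Ex bx]]|none] := pselect (exists x, (E (k0, q) `&` cube b r) x); last first.
  have -> : E (k0, q) `&` cube b r = set0.
    by apply/seteqP; split=> // x h; apply: none; exists x.
  by rewrite hcontent0 lee_fin mulr_ge0 ?powR_ge0//; lra.
have [k [kr rk]] := sc_exists r0.
have kk0 : k <= k0.
  by have := sc_lt_inv (lt_le_trans kr rk0); lia.
have s0 := sc_gt0 (R := R) k.
have p4 : 0 < 4 `^ delta :> R by rewrite powR_gt0.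
have t0 : 0 < 2 * 4 `^ delta * A by rewrite !mulr_gt0.
apply: le_trans (_ : (_ <= H [set y | box k x y /\
   ((2 * 4 `^ delta * A)%:E < `|f y - (m k x)%:E|)%E])%E) _.
  apply: le_hcontent => y [[[_ [_ fy]] [_ /= qy]] by_].
  split.
    move=> i; have /andP[? ?] := by_ i; have /andP[? ?] := bx i.
    by rewrite !mxE; apply/andP; split; lra.
  have [_ [/(_ k kk0) /= mx qx]] := Ex.
  move: fy; case: (f y) => [v| |] /=; rewrite ?ltry// !lte_fin => fy.
  rewrite ltNge; apply/negP => le; move: fy; apply/negP; rewrite -leNgt.
  have -> : v - limit y = (v - m k x) + (m k x - limit x) + (limit x - q%:~R * A) - (limit y - q%:~R * A) by ring.
  apply: le_trans (ler_normB _ _) _.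
  apply: le_trans (lerD (le_trans (ler_normD _ _) (lerD (ler_normD _ _) (lexx _))) (lexx _)) _.
  rewrite /limit_error; lra.
apply: le_trans (box_exceed m_mean k x t0) _.
have le : (2 * sc k) `^ delta <= 4 `^ delta * r `^ delta.
  rewrite -powRM ?(ltW r0)//; apply: (powR_le delta_gt0); first exact/ltW/sc2_gt0.
  by have := scS (R := R) (k - 1); rewrite subrK; lra.
rewrite lee_fin ler_pdivrMr//.
have -> : 1 / 2 * r `^ delta * (2 * 4 `^ delta * A) = A * (4 `^ delta * r `^ delta) by field.
by rewrite ler_pM2l.
Qed.

Local Notation g1 := (weight a W (a 0 0)).
Local Notation g2 := (weight aN W 0).

(** Here 24 is [2 + 2 * 11], from the exponent in [weight_maximal_ge] and [osc_window]; [ln 2] comes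
    from the halving there. *)
Definition log_error : R := 24 + ln 2 + `|ln (weight_const delta / kap)|.

Lemma osc_window : osc_const (6 * jump) W / W <= 11.
Proof.
rewrite ler_pdivrMr//; have := @stop_level_gt0 R n delta A A_gt0.
rewrite /osc_const /window; have := j_gt0; lra.
Qed.

Lemma ln_maximal_weight (a' : int -> 'rV[R]_n -> R) (s : R) x :
  smooth_in_scale a' (6 * jump) -> stopping_covers delta a' W -> ~ bad a' W x ->
  exists2 M : R, hc_maximal delta (EFin \o weight a' W s) x = M%:E &
    0 < M /\ `|W * ln M - (rise a' W x + s)| <= W * log_error.
Proof.
move=> sm cov nb.
have up := weight_maximal_le s delta_gt0 delta_le c0_ge0 W_gt0 sm cov nb.
have lo := weight_maximal_ge s delta_gt0 delta_le c0_ge0 W_gt0 sm cov nb.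
have w0 : 0 < weight a' W s x by rewrite weight_good// expR_gt0.
have wc := weight_const_gt0 delta; have k0 := kappa_gt0 delta.
have l0 : 0 < expR (- ((2 * W + 2 * osc_const (6 * jump) W) / W)) / 2 * weight a' W s x.
  by rewrite !mulr_gt0 ?expR_gt0 ?invr_gt0.
move: up lo; case: (hc_maximal _ _ _) => [M| |]//; rewrite !lee_fin => up lo.
have M0 : 0 < M by exact: lt_le_trans lo.
exists M => //; split=> //.
have -> : W * ln M - (rise a' W x + s) = W * (ln M - (rise a' W x + s) / W).
  by rewrite mulrBr [W * (_ / W)]mulrC divfK// gt_eqF.
rewrite normrM (ger0_norm (ltW W_gt0)) ler_pM2l//.
have lnw : ln (weight a' W s x) = (rise a' W x + s) / W by rewrite weight_good// expRK.
have wk0 : 0 < weight_const delta / kap by rewrite divr_gt0.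
move: up lo l0; set o := osc_const _ _; set w := weight _ _ _ _ in lnw w0 *.
rewrite /log_error; set wk := weight_const delta / kap in wk0 * => up lo l0; clearbody wk.
have up' : ln M <= ln wk + 2 * o / W + (rise a' W x + s) / W.
  rewrite -lnw -(expRK (2 * o / W)) -!lnM ?posrE ?mulr_gt0 ?expR_gt0//.
  by rewrite ler_ln ?posrE ?mulr_gt0 ?expR_gt0.
have lo' : - ((2 * W + 2 * o) / W) - ln 2 + (rise a' W x + s) / W <= ln M.
  rewrite -lnw -(expRK (- _)) -ln_div ?posrE ?expR_gt0// -lnM ?posrE ?divr_gt0 ?expR_gt0//.
  by rewrite ler_ln ?posrE.
have := osc_window; rewrite -/o => ho.
move: up' lo'; have -> : (2 * W + 2 * o) / W = 2 + 2 * (o / W) by field; rewrite gt_eqF.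
have -> : 2 * o / W = 2 * (o / W) by rewrite mulrA.
move=> h1 h2; have := ler_norm (ln wk); have := normr_ge0 (ln wk).
have ln2 : 0 <= ln 2 :> R by rewrite ln_ge0// ler1n.
by rewrite ler_norml => ? ?; apply/andP; split; lra.
Qed.

Definition remainder_bound : R := limit_error + 2 * (W * log_error).

Lemma decomposition : exists b : 'rV[R]_n -> R,
  [/\ (hc_Linfty_norm delta (EFin \o b) <= remainder_bound%:E)%E,
      hc_L1loc delta (EFin \o g1) /\ hc_L1loc delta (EFin \o g2) &
      hc_ae delta (fun x => f x =
        log_maximal_diff delta W W (EFin \o g1) (EFin \o g2) (EFin \o b) x)].
Proof.
pose h x := (W%:E * lne (hc_maximal delta (EFin \o g1) x)
   - W%:E * lne (hc_maximal delta (EFin \o g2) x))%E.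
(* Outside the null set [N] all values are finite and this is the bounded remainder; on [N] the
   default of [fine] is harmless. *)
pose b x := fine (f x - h x)%E.
pose N := bad a W `|` bad aN W `|` exceptional.
have N0 : H N = 0%E.
  rewrite /N hcontentUnull ?hcontent_exceptional// hcontentUnull ?(hcontent_bad W_gt0)//.
have key x : ~ N x -> f x = (h x + (b x)%:E)%E /\ `|b x| <= remainder_bound.
  move=> Nx.
  have nb : ~ bad a W x by move=> ?; apply: Nx; left; left.
  have nbN : ~ bad aN W x by move=> ?; apply: Nx; left; right.
  have [M1 M1E [M10 e1]] := ln_maximal_weight (a 0 0) a_smooth a_covers nb.
  have [M2 M2E [M20 e2]] := ln_maximal_weight 0 aN_smooth aN_covers nbN.
  have : (`|f x - (limit x)%:E| <= limit_error%:E)%E.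
    by rewrite leNgt; apply/negP => ?; apply: Nx; right.
  rewrite /b /h M1E M2E !lne_EFin// -!EFinM -!EFinB.
  case: (f x) => [y| |]//; rewrite -!EFinB -EFinD /= lee_fin => yl.
  split; first by congr EFin; ring.
  have -> : y - (W * ln M1 - W * ln M2) = (y - limit x) -
     (W * ln M1 - (rise a W x + a 0 0)) + (W * ln M2 - (rise aN W x + 0)).
    by rewrite /limit; ring.
  apply: le_trans (ler_normD _ _) _.
  apply: le_trans (lerD (ler_normB _ _) (lexx _)) _.
  rewrite /remainder_bound; lra.
exists b; split.
- have rb0 : 0 < remainder_bound.
    have ln2 : 0 <= ln 2 :> R by rewrite ln_ge0// ler1n.
    have le0 : 0 < log_error.
      by rewrite /log_error; have := normr_ge0 (ln (weight_const delta / kap)); lra.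
    have : 0 < W * log_error by rewrite mulr_gt0.
    have : 0 < 4 `^ delta * A by rewrite mulr_gt0 ?powR_gt0.
    have := j_gt0; have := W_gt0; have := A_gt0.
    rewrite /remainder_bound /limit_error /mean_error; lra.
  apply: ereal_inf_lbound; exists remainder_bound => //; split=> //.
  apply: hcontent_null_sub N0 => x /=; rewrite lte_fin => bx.
  apply: contrapT => /key[_]; by rewrite leNgt bx.
- by split; [exact: (weight_L1loc _ delta_gt0 c0_ge0 W_gt0 a_smooth a_covers)|
    exact: (weight_L1loc _ delta_gt0 c0_ge0 W_gt0 aN_smooth aN_covers)].
- by exists N; split=> // x /key[].
Qed.

End Decomposition.

(** * Homogeneity and the choice of constants *)

Section Assembly.
Context {R : realType} {n : nat}.
Variable delta : R.
Hypothesis delta_gt0 : 0 < delta.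
Hypothesis delta_le : delta <= n%:R.
Local Notation cube := (@cube R n).

Definition total_bound (A : R) : R :=
  @window R n delta A + @window R n delta A + @remainder_bound R n delta A.

(** Every threshold is linear in [A] and [log_error] does not involve it; so a choice of [A]
    proportional to the norm gives a constant free of [f]. *)
Lemma total_boundE A : total_bound A = A * total_bound 1.
Proof.
rewrite /total_bound /remainder_bound /limit_error /mean_error /window /stop_level /jump.
by set L := log_error delta; set p := packing_const _; set k := kappa delta; ring.
Qed.

Lemma total_bound1_gt0 : 0 < total_bound 1.
Proof.
have w := @window_gt0 R n delta 1 ltr01; have j := @jump_gt0 R delta 1 ltr01.
have ln2 : 0 <= ln 2 :> R by rewrite ln_ge0// ler1n.
have L : 0 < log_error delta.
  by rewrite /log_error; have := normr_ge0 (ln (weight_const delta / kappa delta)); lra.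
have wl : 0 < @window R n delta 1 * log_error delta by exact: mulr_gt0.
have p : 0 < 4 `^ delta :> R by rewrite powR_gt0.
by rewrite /total_bound /remainder_bound /limit_error /mean_error; lra.
Qed.

Lemma hc_BMO_norm_ge0 (f : 'rV[R]_n -> \bar R) : (0 <= hc_BMO_norm delta f)%E.
Proof.
apply: (@le_trans _ _ (ereal_inf [set hc_mean delta (cube 0 1) (fun x => `|f x - c%:E|)%E |
                              c in [set: R]])).
  by apply: le_ereal_inf_tmp => _ [c _ <-]; exact: hc_mean_ge0.
by apply: ereal_sup_ubound; exists (cube 0 1) => //; exists 0, 1.
Qed.

Lemma BMO_mean (f : 'rV[R]_n -> \bar R) (A : R) b (r : R) : 0 < A -> 0 < r ->
  (hc_BMO_norm delta f < A%:E)%E ->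
  exists c : R, (choquet delta (cube b r) (fun y => `|f y - c%:E|) <= (A * r `^ delta)%:E)%E.
Proof.
move=> A0 r0 fA.
have [|_ [c _ <-] cA] := @ereal_inf_lt _ [set hc_mean delta (cube b r) (fun x => `|f x - c%:E|)%E |
                              c in [set: R]] A%:E.
  apply: le_lt_trans fA; apply: ereal_sup_ubound.
  by exists (cube b r) => //; exists b, r.
by exists c; apply: (choquet_le_mean delta_gt0 delta_le r0 (ltW A0)); exact: ltW.
Qed.

Lemma BMO_decomposition (f : 'rV[R]_n -> \bar R) :
  hc_BMO delta f -> hc_BMO_norm delta f <> 0%E ->
  exists (alpha beta : R) (b g1 g2 : 'rV[R]_n -> R),
    [/\ 0 < alpha /\ 0 < beta,
        hc_Linfty delta (EFin \o b),
        hc_L1loc delta (EFin \o g1) /\ hc_L1loc delta (EFin \o g2),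
        hc_ae delta (fun x => f x =
          log_maximal_diff delta alpha beta (EFin \o g1) (EFin \o g2) (EFin \o b) x) &
        ((alpha + beta)%:E + hc_Linfty_norm delta (EFin \o b)
          <= (2 * total_bound 1)%:E * hc_BMO_norm delta f)%E].
Proof.
move=> [_ fin] nz.
have fn : hc_BMO_norm delta f \is a fin_num by rewrite ge0_fin_numE// hc_BMO_norm_ge0.
pose N := fine (hc_BMO_norm delta f); have NE : hc_BMO_norm delta f = N%:E by rewrite fineK.
have N0 : 0 < N.
  rewrite lt_def -lee_fin -NE hc_BMO_norm_ge0 andbT; apply/eqP => N0.
  by apply: nz; rewrite NE N0.
(* Twice the norm leaves room for near-optimal constants, as the infimum over constants need not be
   attained. *)
have A0 : 0 < 2 * N by rewrite mulr_gt0.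
have fA : (hc_BMO_norm delta f < (2 * N)%:E)%E by rewrite NE lte_fin; lra.
have : forall kx : int * 'rV[R]_n, exists c : R,
   (choquet delta (box kx.1 kx.2) (fun y => `|f y - c%:E|) <= (2 * N * (2 * sc kx.1) `^ delta)%:E)%E.
  by move=> [k x]; apply: BMO_mean => //; exact: sc2_gt0.
move=> /choice[m mP].
have [b [bn [L1 L2] ae]] := @decomposition R n delta (2 * N) f (fun k x => m (k, x))
  delta_gt0 delta_le A0 (fun k x => mP (k, x)).
pose W := @window R n delta (2 * N).
pose u := smooth_mean delta (2 * N) (fun k x => m (k, x)).
exists W, W, b, (weight u W (u 0 0)), (weight (fun k x => - u k x) W 0).
have W0 : 0 < W by exact: window_gt0.
split; [exact: (conj W0 W0)|exact: (le_lt_trans bn (ltry _))|exact: (conj L1 L2)|exact: ae|].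
apply: le_trans (leeD (lexx _) bn) _.
rewrite NE -EFinD -EFinM lee_fin -[leLHS]/(total_bound (2 * N)) total_boundE.
by rewrite le_eqVlt; apply/orP; left; apply/eqP; ring.
Qed.

End Assembly.

Local Open Scope ereal_scope.

Theorem theorem1p7 (R : realType) (n : nat) (delta : R)
    (delta_gt0 : (0 < delta)%R) (delta_le : (delta <= n%:R)%R) :
  (exists C : R, (0 < C)%R /\
    forall f : 'rV[R]_n -> \bar R,
      hc_BMO delta f -> hc_BMO_norm delta f <> 0 ->
      exists (alpha beta : R) (b g1 g2 : 'rV[R]_n -> R),
        [/\ (0 < alpha)%R /\ (0 < beta)%R,
            hc_Linfty delta (EFin \o b),
            hc_L1loc delta (EFin \o g1) /\ hc_L1loc delta (EFin \o g2),
            hc_ae delta (fun x => f x =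
              log_maximal_diff delta alpha beta
                (EFin \o g1) (EFin \o g2) (EFin \o b) x) &
            (alpha + beta)%:E + hc_Linfty_norm delta (EFin \o b)
              <= C%:E * hc_BMO_norm delta f]) /\
  (exists C : R, (0 < C)%R /\
    forall (alpha beta : R) (b g1 g2 : 'rV[R]_n -> \bar R),
      (0 < alpha)%R -> (0 < beta)%R ->
      hc_Linfty delta b -> hc_L1loc delta g1 -> hc_L1loc delta g2 ->
      (* the maximal functions do not vanish identically, so that their
         logarithms are defined *)
      (exists x, hc_maximal delta g1 x <> 0) ->
      (exists x, hc_maximal delta g2 x <> 0) ->
      hc_ae delta (fun x => hc_maximal delta g1 x < +oo) ->
      hc_ae delta (fun x => hc_maximal delta g2 x < +oo) ->
      let f := log_maximal_diff delta alpha beta g1 g2 b in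
      hc_BMO delta f /\
      hc_BMO_norm delta f
        <= C%:E * ((alpha + beta)%:E + hc_Linfty_norm delta b)).
Proof.
split.
  exists (2 * @total_bound R n delta 1)%R; split.
    by rewrite mulr_gt0// total_bound1_gt0.
  move=> f; exact: BMO_decomposition.
exists (@converse_const R n delta); split; first exact: converse_const_gt0.
move=> alpha beta b g1 g2 a0 b0 bL _ _; exact: log_maximal_diff_BMO.
Qed.
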